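(* Let $(r_j)_{j\in\mathbb{N}}$ be a sequence of real numbers such that $\inf_{j\in\mathbb{N}}r_j>1/2$. Let $(g_j)_{j\in\mathbb{N}}$ be a sequence of positive real numbers such that $\sup_{j\in\mathbb{N}}g_j\leqslant 1$. For every $d\in\mathbb{N}$ let $\mathbb{B}_d=\otimes_{j=1}^d B_{g_j,r_j}$ be the zero-mean random element of $L_2([0,1]^d)$ given by a zero-mean random field on $[0,1]^d$ with covariance function $$\mathcal{K}^{\mathbb{B}_d}(t,s)=\prod_{j=1}^d\Bigl(1+2g_j\sum_{k=1}^\infty k^{-2r_j}\cos\bigl(2\pi k(t_j-s_j)\bigr)\Bigr),\qquad t,s\in[0,1]^d.$$ The sequence of approximation problems for $\mathbb{B}_d$, $d\in\mathbb{N}$, is quasi-polynomially tractable if and only if $$\sup_{d\in\mathbb{N}}\ \frac{1}{\ln_+ d}\sum_{j=1}^d(1+|\ln g_j|)\,g_j<\infty.$$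
   Context: $\mathbb{N}$ is the set of positive integers. $\ln_+ x=\max\{1,\ln x\}$ for $x>0$. For $g\in(0,1]$ and $r>1/2$, $B_{g,r}(t)$, $t\in[0,1]$, is a zero-mean random process with covariance function (Korobov kernel) $\mathcal{K}^{B_{g,r}}(t,s)=1+2g\sum_{k=1}^\infty k^{-2r}\cos(2\pi k(t-s))$, $t,s\in[0,1]$, regarded as a random element of $L_2([0,1])$; its covariance operator $K^{B_{g,r}}$ is the integral operator on $L_2([0,1])$ with this kernel, whose eigenvalues are $\lambda_1=1$, $\lambda_{2k}=\lambda_{2k+1}=g k^{-2r}$, $k\in\mathbb{N}$. The covariance operator of $\mathbb{B}_d$ is the integral operator on $L_2([0,1]^d)=\otimes_{j=1}^d L_2([0,1])$ with kernel $\mathcal{K}^{\mathbb{B}_d}$, i.e. $K^{\mathbb{B}_d}=\otimes_{j=1}^d K^{B_{g_j,r_j}}$; this is what the notation $\mathbb{B}_d=\otimes_{j=1}^d B_{g_j,r_j}$ means. For a zero-mean random element $X_d$ of a separable Hilbert space $H_d$ with $\mathbb{E}\|X_d\|_{H_d}^2<\infty$, let $$e^{X_d}(n)=\inf\Bigl\{\bigl(\mathbb{E}\|X_d-\widetilde X\|_{H_d}^2\bigr)^{1/2}:\ \widetilde X=\sum_{m=1}^n l_m(X_d)\psi_m,\ \psi_m\in H_d,\ l_m\in H_d^*\Bigr\},\quad n\in\mathbb{N},$$ where $H_d^*$ is the space of continuous linear functionals on $H_d$, and $e^{X_d}(0)=(\mathbb{E}\|X_d\|_{H_d}^2)^{1/2}$.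 The average case approximation complexity is $$n^{X_d}(\varepsilon)=\min\{n\in\mathbb{N}:\ e^{X_d}(n)\leqslant\varepsilon\,e^{X_d}(0)\},\qquad \varepsilon\in(0,1).$$ Equivalently, if $(\lambda^{X_d}_k)_{k\in\mathbb{N}}$ is the non-increasing sequence of eigenvalues of the covariance operator of $X_d$ (extended by zeros in the finite-dimensional case) and $\Lambda^{X_d}=\sum_{k}\lambda^{X_d}_k$, then $n^{X_d}(\varepsilon)=\min\{n\in\mathbb{N}:\sum_{k=n+1}^\infty\lambda^{X_d}_k\leqslant\varepsilon^2\Lambda^{X_d}\}$. For a tensor product of $X_{1,1},\dots,X_{1,d}$ these eigenvalues are the products $\prod_{j=1}^d\lambda^{X_{1,j}}_{k_j}$, $k_1,\dots,k_d\in\mathbb{N}$, of the eigenvalues of the marginal covariance operators, arranged in non-increasing order. The sequence of approximation problems for $X_d$, $d\in\mathbb{N}$, is called quasi-polynomially tractable if there are numbers $C>0$ and $s\geqslant 0$ such that $$n^{X_d}(\varepsilon)\leqslant C\exp\bigl\{s(1+\ln\varepsilon^{-1})(1+\ln d)\bigr\}\quad\text{for all } d\in\mathbb{N},\ \varepsilon\in(0,1).$$ *)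

(* Defs.v *)
From HB Require Import structures.
From mathcomp Require Import all_boot all_order all_algebra.
From mathcomp Require Import all_classical all_reals all_analysis.

Set Implicit Arguments.
Unset Strict Implicit.
Unset Printing Implicit Defensive.

Import Order.TTheory GRing.Theory Num.Theory.
Import numFieldNormedType.Exports.

Local Open Scope classical_set_scope.
Local Open Scope ring_scope.

(* The set N of positive integers is rendered by [nat] together with the
   condition [0 < n]; sequences are functions on [nat] whose value at 0 is
   never used. *)

Section cube.
Context {R : realType}.

Definition unit_cube (d : nat) : set (d.-tuple R) :=
  [set t | forall i : 'I_d, 0 <= tnth t i <= 1].

Definition tcons (d : nat) (x : measurableTypeR R * d.-tuple R) : d.+1.-tuple R :=
  [tuple of x.1 :: x.2].

Lemma measurable_tcons d : measurable_fun setT (@tcons d).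
Proof. exact: measurable_cons. Qed.

HB.instance Definition _ d :=
  isMeasurableFun.Build _ _ _ _ (@tcons d) (@measurable_tcons d).

(* The d-fold product of the Lebesgue measure of [0, 1] (which is the uniform
   probability on [0, 1]), i.e. the Lebesgue measure of [0, 1]^d seen as a
   measure on R^d carried by the unit cube. *)
Fixpoint cube_measure (d : nat) : probability (d.-tuple R) R :=
  match d with
  | 0 => dirac [tuple]
  | d'.+1 => distribution (uniform_prob (@ltr01 R) \x cube_measure d')%E
                          (@tcons d')
  end.

End cube.

Section L2.
Context {disp : measure_display} {T : measurableType disp} {R : realType}.
Variable mu : {measure set T -> \bar R}.

(* Square-integrable functions, a vector space with the semi-norm 'N[mu]_2;
   two of them are the same element of L_2(mu) iff their difference has
   semi-norm 0. *)
Definition L2 := LfunType mu (lee1n 2).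

(* Continuity for the L_2(mu) semi-norm. Such an l does not see mu-null
   sets, so these are exactly the continuous functionals on L_2(mu). *)
Definition L2_continuous (l : L2 -> R) : Prop :=
  forall (f : L2) (e : R), 0 < e -> exists2 del : R, 0 < del &
    forall h : L2,
      ('N[mu]_2%:E[EFin \o (h - f)%R] < del%:E)%E -> `|l h - l f| < e.

Section approximation.
Context {disp' : measure_display} {Om : measurableType disp'}.
Variables (P : probability Om R) (X : Om -> L2).

(* (E ||X - sum_(m < n) l_m(X) psi_m||^2)^(1/2) *)
Definition mean_square_error (n : nat) (l : 'I_n -> {scalar L2})
    (psi : 'I_n -> L2) : \bar R :=
  ((\int[P]_w
      'N[mu]_2%:E[EFin \o (X w - \sum_(m < n) l m (X w) *: psi m)%R] `^ 2)
   `^ 2^-1)%E.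

(* For n = 0 the sum is empty and this is (E ||X||^2)^(1/2). *)
Definition avg_error (n : nat) : \bar R :=
  ereal_inf [set e | exists (l : 'I_n -> {scalar L2}) (psi : 'I_n -> L2),
    (forall m, L2_continuous (l m)) /\ e = mean_square_error l psi].

(* A minimum over positive integers, equal to +oo if there is none. *)
Definition avg_complexity (eps : R) : \bar R :=
  ereal_inf [set (n%:R)%:E | n in
    [set n : nat | (0 < n)%N /\ (avg_error n <= eps%:E * avg_error 0)%E]].

End approximation.

End L2.

(* A measurable zero-mean second order random field on D with covariance
   function K, with sample paths in L_2(mu). It is defined on all of T, but
   the law of the process is prescribed on D only; this is meant for a
   measure mu carried by D. *)
Definition zero_mean_field {disp disp' : measure_display}
    {T : measurableType disp} {Om : measurableType disp'} {R : realType}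
    (mu : {measure set T -> \bar R}) (P : probability Om R)
    (D : set T) (K : T -> T -> R) (X : Om -> L2 mu) : Prop :=
  [/\ measurable_fun setT (fun z : Om * T => X z.1 z.2),
      forall t, D t -> (fun w => X w t) \in Lfun P 2%:E,
      forall t, D t -> ('E_P[fun w => X w t] = 0)%E &
      forall t s, D t -> D s ->
        (covariance P (fun w => X w t) (fun w => X w s) = (K t s)%:E)%E].

Definition korobov_kernel {R : realType} (g r t s : R) : R :=
  1 + 2 * g * \big[+%R/0]_(1 <= k <oo)
    (k%:R `^ (- (2 * r)) * cos (2 * pi * k%:R * (t - s))).

(* [tnth] counts the coordinates from 0, whereas g and r are indexed from 1. *)
Definition tensor_korobov_kernel {R : realType} (g r : nat -> R) (d : nat)
    (t s : d.-tuple R) : R :=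
  \prod_(j < d) korobov_kernel (g j.+1) (r j.+1) (tnth t j) (tnth s j).

Definition ln_plus {R : realType} (x : R) : R := Num.max 1 (ln x).

(* [n d eps] is the complexity of the d-th problem. *)
Definition quasi_polynomially_tractable {R : realType}
    (n : nat -> R -> \bar R) : Prop :=
  exists C s : R, [/\ 0 < C, 0 <= s &
    forall (d : nat) (eps : R), (0 < d)%N -> 0 < eps < 1 ->
      (n d eps <=
        (C * expR (s * (1 + ln eps^-1) * (1 + ln d%:R)))%:E)%E].

(* Main.v *)
Require Import Defs.
From HB Require Import structures.
From mathcomp Require Import all_boot all_order all_algebra.
From mathcomp Require Import all_classical all_reals all_analysis.
From mathcomp Require Import measurable_realfun.
From mathcomp Require Import ring lra.

(** Write lambda_i for the products of the univariate eigenvalues and Lambda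
    for their sum. The argument only ever looks at the finitely many
    lambda_i whose frequencies are at most N, and lets N grow with the
    precision needed; this replaces the spectral theorem and the sorting of
    the eigenvalues.

    From fields to eigenvalues. Products of cosines and sines are
    orthonormal eigenfunctions of the tensor kernel ([tensor_kernel_eigen]),
    so by Fubini the coordinates of the field along them are uncorrelated
    with variances lambda_i ([expectation_coordinates]), while the mean
    squared norm of the field is Lambda, the constant value of the kernel on
    the diagonal. Keeping the coordinates in a finite set S therefore leaves
    the mean squared error Lambda minus the sum of lambda_i over S
    ([avg_error_le]). Conversely the squared error of any approximation of
    rank n is pathwise at least the squared distance of the vector of
    coordinates to a subspace of dimension n; its mean is the sum of
    lambda_i (1 - p_i), where the p_i are the diagonal entries of a
    projection, hence lie in [0, 1] and add up to at most n
    ([avg_error_lt]).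

    The condition suffices. With q = eta / ln_+ d the power sum of the
    lambda_i with exponent 1 - q factorizes over the coordinates, and the
    j-th factor is at most the (1 - q)-th power of the univariate trace
    times exp(C (g_j^(1-q) - g_j + q g_j)). As g^(1-q) - g is about q g |ln g|,
    the condition bounds the product by a constant M, uniformly in d
    ([power_sum_le]). A Chebyshev count shows that M (M / delta)^(1/q)
    eigenvalues carry all but the fraction delta of the trace
    ([large_eigenvalues_set]), and 1/q is a multiple of ln_+ d.

    The condition is necessary. Take error level 1/2 and n terms, where
    ln (10 n) <= v for a multiple v of 1 + ln d. All lambda_i are at most 1, so
    capturing a fixed fraction of Lambda forces Lambda <= 10 n, which bounds
    the sum of the g_j by 2 v. Moreover the lambda_i above 1/(10 n) carry half of
    the trace, so the power sum with exponent 1 + 1/v is still comparable to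
    the trace ([rank_weights_bounds]). It factorizes again, and the j-th
    factor is at most the univariate trace times exp(- c g_j (1 -
    g_j^(1/v))), so the g_j (1 - g_j^(1/v)) have a bounded sum. This
    quantity is at least of the order of g_j |ln g_j| / v, except when g_j <
    d^-2, and such terms only add O(1) ([mul_norm_ln_le]). *)

Set Implicit Arguments.
Unset Strict Implicit.
Unset Printing Implicit Defensive.
Import Order.TTheory GRing.Theory Num.Theory.
Import numFieldNormedType.Exports.

Local Open Scope classical_set_scope.
Local Open Scope ring_scope.

(** * Orthogonal projections in real row vectors *)

Section orthogonal_projection.
Variable R : realFieldType.

Definition sqnorm (N : nat) (x : 'rV[R]_N) : R := \sum_k x 0 k ^+ 2.

Lemma sqnormE N (x : 'rV[R]_N) : sqnorm x = (x *m x^T) 0 0.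
Proof. by rewrite mxE; apply: eq_bigr => k _; rewrite mxE expr2. Qed.

Lemma sqnorm_ge0 N (x : 'rV[R]_N) : 0 <= sqnorm x.
Proof. by apply: sumr_ge0 => k _; exact: sqr_ge0. Qed.

Lemma sqnorm_eq0 N (x : 'rV[R]_N) : sqnorm x = 0 -> x = 0.
Proof.
move=> x0; apply/rowP => k; rewrite mxE; apply/eqP; rewrite -sqrf_eq0.
by move: x0 => /eqP; rewrite psumr_eq0 => [/allP/(_ k (mem_index_enum _))|i _];
  rewrite ?sqr_ge0.
Qed.

Lemma sqnormD_orth N (x y : 'rV[R]_N) :
  x *m y^T = 0 -> sqnorm (x + y) = sqnorm x + sqnorm y.
Proof.
move=> xy; have yx : y *m x^T = 0 by rewrite -[LHS]trmxK trmx_mul trmxK xy trmx0.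
rewrite !sqnormE linearD /= mulmxDl !mulmxDr xy yx addr0 add0r.
by rewrite mxE.
Qed.

(** A vector killed by the Gram matrix B B^T is killed by B,
    since its image under B has squared norm 0. *)
Lemma gram_unitmx r N (B : 'M[R]_(r, N)) : row_free B -> B *m B^T \in unitmx.
Proof.
move=> Bfree; rewrite -row_free_unit -kermx_eq0; apply/rowV0P => v /sub_kermxP vB.
have : sqnorm (v *m B) = 0.
  by rewrite sqnormE trmx_mul mulmxA -(mulmxA v) vB mul0mx mxE.
by move=> /sqnorm_eq0 /eqP; rewrite mulmx_free_eq0 // => /eqP.
Qed.

(** For a row base B of A the projection is B^T (B B^T)^-1 B; cyclicity
    of the trace turns its trace into that of the identity of size rank A. *)
Lemma orthogonal_projection_exists n N (A : 'M[R]_(n, N)) :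
  exists Q : 'M[R]_N, [/\ Q^T = Q, Q *m Q = Q, A *m Q = A & \tr Q <= n%:R].
Proof.
have [r [B [Bfree AB rn]]] : exists r (B : 'M[R]_(r, N)),
    [/\ row_free B, (A <= B)%MS & (r <= n)%N].
  exists (\rank A), (row_base A).
  by rewrite row_base_free eq_row_base rank_leq_row.
have uG := gram_unitmx Bfree; set G := B *m B^T in uG.
have GT : G^T = G by rewrite /G trmx_mul trmxK.
exists (B^T *m invmx G *m B); split.
- by rewrite !trmx_mul trmxK trmx_inv GT mulmxA.
- rewrite -!mulmxA; congr (_ *m _); rewrite !mulmxA -(mulmxA _ B) -/G.
  by rewrite mulVmx // mul1mx.
- have /submxP[D AE] := AB; rewrite [in LHS]AE [RHS]AE.
  by rewrite -!mulmxA (mulmxA B B^T) -/G (mulmxA G) mulmxV // mul1mx.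
- rewrite -mulmxA mxtrace_mulC -mulmxA -/G mulVmx // mxtrace1.
  by rewrite ler_nat.
Qed.

Section projection.
Variables (N : nat) (Q : 'M[R]_N).
Hypotheses (QT : Q^T = Q) (QQ : Q *m Q = Q).

(** Idempotence and symmetry make Q k k the squared norm of the k-th row,
    so Q k k is nonnegative and dominates its own square. *)
Lemma projection_diag k : 0 <= Q k k <= 1.
Proof.
have QkE : Q k k = \sum_l Q k l ^+ 2.
  rewrite -{1}QQ mxE; apply: eq_bigr => l _.
  by rewrite expr2; congr (_ * _); rewrite -[in LHS]QT mxE.
have Qk0 : 0 <= Q k k by rewrite QkE sumr_ge0 // => l _; exact: sqr_ge0.
have : Q k k ^+ 2 <= Q k k.
  by rewrite [leRHS]QkE (bigD1 k) //= lerDl sumr_ge0 // => l _; exact: sqr_ge0.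
by rewrite Qk0 /=; nra.
Qed.

(** The quadratic form of the residual is what can be averaged: once the
    coordinates of x are uncorrelated only the diagonal terms survive. *)
Lemma sqnorm_residual (x : 'rV[R]_N) :
  (sqnorm (x *m (1%:M - Q))) =
  \sum_k \sum_l x 0 k * x 0 l * ((k == l)%:R - Q k l).
Proof.
have resT : (1%:M - Q)^T = 1%:M - Q by rewrite linearB /= trmx1 QT.
have res2 : (1%:M - Q) *m (1%:M - Q) = 1%:M - Q.
  by rewrite mulmxBl mul1mx mulmxBr mulmx1 QQ subrr subr0.
have -> : sqnorm (x *m (1%:M - Q)) = (x *m (1%:M - Q) *m x^T) 0 0.
  by rewrite sqnormE trmx_mul resT mulmxA -(mulmxA x) res2.
rewrite mxE exchange_big /=; apply: eq_bigr => l _.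
rewrite !mxE big_distrl /=; apply: eq_bigr => k _.
by rewrite !mxE; ring.
Qed.

(** Pythagoras: x Q is the point of the range of Q closest to x. *)
Lemma sqnorm_residual_le (x y : 'rV[R]_N) : y *m Q = y ->
  sqnorm (x *m (1%:M - Q)) <= sqnorm (x - y).
Proof.
move=> yQ.
have -> : x - y = (x - y) *m Q + x *m (1%:M - Q).
  by rewrite mulmxBl yQ mulmxBr mulmx1; apply/rowP => k; rewrite !mxE; ring.
rewrite sqnormD_orth ?lerDr ?sqnorm_ge0 //.
rewrite trmx_mul linearB /= trmx1 QT mulmxA -(mulmxA _ Q).
by rewrite mulmxBr mulmx1 QQ subrr mulmx0 mul0mx.
Qed.

End projection.
End orthogonal_projection.

(** * The inner product of L2 *)

Section inner_product.
Context {disp : measure_display} {T : measurableType disp} {R : realType}.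
Variable mu : {measure set T -> \bar R}.

(** Stated for bare functions, so that membership in L2 is only required
    where bilinearity is used. *)
Definition ip (f h : T -> R) : R := \int[mu]_t (f t * h t).

Lemma L2_Lfun (f : L2 mu) : (f : T -> R) \in Lfun mu 2%:E.
Proof. exact: LfunP. Qed.

Lemma ip_integrable (f h : L2 mu) :
  mu.-integrable setT (fun t => (f t * h t)%:E).
Proof. by apply/(Lfun1_integrable mu)/Lfun2_mul_Lfun1; exact: L2_Lfun. Qed.

Lemma ipC (f h : L2 mu) : ip f h = ip h f.
Proof. by apply: eq_Rintegral => t _; rewrite mulrC. Qed.

Lemma ipDl (f g h : L2 mu) : ip (f + g) h = ip f h + ip g h.
Proof.
rewrite -RintegralD //; [|exact: ip_integrable|exact: ip_integrable].
by apply: eq_Rintegral => t _; rewrite -mulrDl.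
Qed.

Lemma ipZl a (f h : L2 mu) : ip (a *: f) h = a * ip f h.
Proof.
rewrite -RintegralZl //; last exact: ip_integrable.
by apply: eq_Rintegral => t _; rewrite mulrA.
Qed.

Lemma ip_ge0 (f : L2 mu) : 0 <= ip f f.
Proof. by apply: Rintegral_ge0 => t _; rewrite -expr2 sqr_ge0. Qed.

Lemma ip0l (h : L2 mu) : ip (0 : L2 mu) h = 0.
Proof. by rewrite -(scale0r (0 : L2 mu)) ipZl mul0r. Qed.

Lemma ipNl (f h : L2 mu) : ip (- f) h = - ip f h.
Proof. by rewrite -scaleN1r ipZl mulN1r. Qed.

Lemma ipBl (f g h : L2 mu) : ip (f - g) h = ip f h - ip g h.
Proof. by rewrite ipDl ipNl. Qed.

Lemma ipBr (f g h : L2 mu) : ip h (f - g) = ip h f - ip h g.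
Proof. by rewrite ipC ipBl ipC (ipC g). Qed.

Lemma ip_suml I (s : seq I) (F : I -> L2 mu) (h : L2 mu) :
  ip (\sum_(i <- s) F i) h = \sum_(i <- s) ip (F i) h.
Proof.
elim: s => [|i s IH]; first by rewrite !big_nil ip0l.
by rewrite !big_cons ipDl IH.
Qed.

Lemma L2norm_sqr (f : L2 mu) :
  ('N[mu]_2%:E[EFin \o f] `^ 2 = (ip f f)%:E)%E.
Proof.
rewrite poweR_Lnorm // /ip /Rintegral fineK; last first.
  exact: (integrable_fin_num measurableT (ip_integrable f f)).
apply: eq_integral => t _ /=; rewrite powR_mulrn // -normrX ger0_norm ?sqr_ge0 //.
Qed.

Lemma L2norm_fin (f : L2 mu) : ('N[mu]_2%:E[EFin \o f] \is a fin_num)%E.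
Proof.
by rewrite ge0_fin_numE ?Lnorm_ge0 //; exact: Lfunction_finite.
Qed.

Lemma L2norm_sqrt (f : L2 mu) :
  ('N[mu]_2%:E[EFin \o f] = (Num.sqrt (ip f f))%:E)%E.
Proof.
have := L2norm_sqr f; have := Lnorm_ge0 mu 2%:E (EFin \o f).
rewrite -(fineK (L2norm_fin f)); set x := fine _ => x0 /=.
rewrite lee_fin in x0.
by case=> <-; rewrite powR_mulrn // sqrtr_sqr ger0_norm.
Qed.

Lemma ip_CauchySchwarz (f h : L2 mu) :
  (`|ip f h| <= Num.sqrt (ip f f) * Num.sqrt (ip h h)).
Proof.
have half : (2^-1 + 2^-1 = 1 :> R) by lra.
have := @hoelder _ _ _ mu f h 2 2 (measurable_funPT f) (measurable_funPT h).
rewrite ltr0n => /(_ isT isT half).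
rewrite Lnorm1 !L2norm_sqrt -EFinM => /(le_trans _) le_norms.
rewrite -lee_fin; apply: le_norms.
rewrite EFin_normr_Rintegral //; last exact: ip_integrable.
by apply: le_abse_integral => //; case/integrableP: (ip_integrable f h).
Qed.

Lemma ip_continuous (phi : L2 mu) : L2_continuous (fun f : L2 mu => ip f phi).
Proof.
move=> f e e0; set c := Num.sqrt (ip phi phi).
have c0 : 0 <= c by exact: sqrtr_ge0.
exists (e / (c + 1)); first by rewrite divr_gt0 // ltr_pwDr.
move=> h; rewrite L2norm_sqrt lte_fin ltr_pdivlMr ?ltr_pwDr // => hf.
rewrite -ipBl (le_lt_trans (ip_CauchySchwarz _ _)) // (le_lt_trans _ hf) //.
by rewrite ler_wpM2l ?sqrtr_ge0 // lerDl.
Qed.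

Section orthonormal.
Variables (N : nat) (phi : 'I_N -> L2 mu).
Hypothesis phi_orth : forall k l, ip (phi k) (phi l) = (k == l)%:R.

Lemma ip_lincomb_phi (a : 'I_N -> R) l :
  ip (\sum_k a k *: phi k) (phi l) = a l.
Proof.
rewrite ip_suml (bigD1 l) //= ipZl phi_orth eqxx mulr1 big1 ?addr0 // => k kl.
by rewrite ipZl phi_orth (negbTE kl) mulr0.
Qed.

Lemma ip_residual (f : L2 mu) :
  let g := f - \sum_k ip f (phi k) *: phi k in
  ip g g = ip f f - \sum_k ip f (phi k) ^+ 2.
Proof.
set s := \sum_k _ => g.
have fs : ip f s = \sum_k ip f (phi k) ^+ 2.
  by rewrite ipC ip_suml; apply: eq_bigr => k _; rewrite ipZl (ipC (phi k)) expr2.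
have ss : ip s s = \sum_k ip f (phi k) ^+ 2.
  rewrite {1}/s ip_suml; apply: eq_bigr => k _.
  by rewrite ipZl (ipC (phi k) s) ip_lincomb_phi expr2.
by rewrite ipBl !ipBr (ipC s f) fs ss; ring.
Qed.

Lemma bessel (f : L2 mu) : \sum_k ip f (phi k) ^+ 2 <= ip f f.
Proof. by rewrite -subr_ge0 -ip_residual ip_ge0. Qed.

End orthonormal.
End inner_product.

(** * Coordinates of a random field *)

Section random_field.
Context {disp disp' : measure_display} {T : measurableType disp}
  {Om : measurableType disp'} {R : realType}.
Variables (mu : probability T R) (P : probability Om R).
Local Open Scope ereal_scope.

(** Domination of |U V| by U^2 + V^2; this meets the integrability
    conditions of the Fubini exchanges for the field. *)
Lemma integrable_mul_bounded d (S : measurableType d)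
    (m : {measure set S -> \bar R}) (U V W : S -> R) (c : R) :
  measurable_fun setT U -> measurable_fun setT V -> measurable_fun setT W ->
  (forall z, `|W z| <= c)%R ->
  m.-integrable setT (fun z => (U z ^+ 2)%:E) ->
  m.-integrable setT (fun z => (V z ^+ 2)%:E) ->
  m.-integrable setT (fun z => (U z * V z * W z)%:E).
Proof.
move=> mU mV mW Wc iU iV.
have := integrableZl measurableT c (integrableD measurableT iU iV).
apply: le_integrable => //.
  by apply/measurable_EFinP; do 2 apply: measurable_funM => //.
move=> z _ /=; rewrite lee_fin !normrM.
have c0 : (0 <= c)%R by exact: le_trans (Wc z).
rewrite (ger0_norm c0) (@ger0_norm _ (_ + _)%R) ?addr_ge0 ?sqr_ge0 //.
rewrite mulrC ler_pM ?mulr_ge0 ?normr_ge0 //.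
rewrite -(real_normK (num_real (U z))) -(real_normK (num_real (V z))).
have := sqr_ge0 (`|U z| - `|V z|).
have := normr_ge0 (U z); have := normr_ge0 (V z).
nra.
Qed.

Lemma integrable_mul_sqr d (S : measurableType d)
    (m : {measure set S -> \bar R}) (U V : S -> R) :
  measurable_fun setT U -> measurable_fun setT V ->
  m.-integrable setT (fun z => (U z ^+ 2)%:E) ->
  m.-integrable setT (fun z => (V z ^+ 2)%:E) ->
  m.-integrable setT (fun z => (U z * V z)%:E).
Proof.
move=> mU mV iU iV.
have c1 (z : S) : (`|cst (1 : R) z| <= 1)%R by rewrite normr1.
have := integrable_mul_bounded mU mV (@measurable_cst _ _ _ _ _ (1%R : R)) c1 iU iV.
by apply: eq_integrable => // z _; rewrite /= mulr1.
Qed.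

Lemma integrable_fst (f : Om -> R) :
  P.-integrable setT (EFin \o f) ->
  (P \x mu).-integrable setT (fun z : Om * T => (f z.1)%:E).
Proof.
move=> /integrableP[mf fi]; apply/integrable12ltyP.
  by apply: (measurableT_comp mf).
rewrite [ltLHS](_ : _ = \int[P]_w `|(f w)%:E|) //.
apply: eq_integral => w _ /=; rewrite integral_cst //=.
by rewrite probability_setT mule1.
Qed.

Variables (X : Om -> L2 mu) (D : set T) (K : T -> T -> R) (Lam : R).
Hypotheses (HX : zero_mean_field P D K X) (mD : measurable D)
  (muD : mu (~` D) = 0) (K_diag : forall t, D t -> K t t = Lam)
  (mK : forall t, measurable_fun setT (K t)).

Let mX : measurable_fun setT (fun z : Om * T => X z.1 z.2).
Proof. by case: HX. Qed.

Let mXt t : measurable_fun setT (fun w => X w t).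
Proof. exact: (measurableT_comp mX (pair2_measurable t)). Qed.

Let X_sqr_integrable t : D t -> P.-integrable setT (fun w => (X w t ^+ 2)%:E).
Proof. by case: HX => _ X2 _ _ /X2 /Lfun2_integrable_sqr. Qed.

Lemma expectation_mul t s : D t -> D s ->
  \int[P]_w (X w t * X w s)%:E = (K t s)%:E.
Proof.
move=> Dt Ds; case: HX => _ _ X0 /(_ t s Dt Ds) <-.
rewrite unlock X0 // X0 //= unlock; apply: eq_integral => w _ /=.
by rewrite [in RHS]/GRing.mul /= !subr0.
Qed.

(** The covariance of the field is prescribed on D only, so that integrals
    over T are compared up to the null set outside D. *)
Lemma ae_in_D (f g : T -> \bar R) :
  (forall t, D t -> f t = g t) -> ae_eq mu setT f g.
Proof.
move=> fg; exists (~` D); split => //; first exact: measurableC.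
by move=> t /= nfg Dt; apply: nfg => _; exact: fg.
Qed.

(** Tonelli: the mean squared norm is the integral of the diagonal of the
    covariance function. *)
Lemma expectation_ip_self : \int[P]_w (ip mu (X w) (X w))%:E = Lam%:E.
Proof.
pose f (z : Om * T) := (X z.1 z.2 * X z.1 z.2)%:E.
have mf : measurable_fun setT f by apply/measurable_EFinP; exact: measurable_funM.
have f0 z : 0 <= f z by rewrite lee_fin -expr2 sqr_ge0.
transitivity (\int[P]_w \int[mu]_t f (w, t)).
  apply: eq_integral => w _; rewrite fineK //.
  exact: (integrable_fin_num measurableT (ip_integrable _ _)).
rewrite fubini_tonelli //.
transitivity (\int[mu]_t (cst Lam%:E t)).
  apply: ae_eq_integral => //; first exact: measurable_fun_fubini_tonelli_G.
  by apply: ae_in_D => t Dt; rewrite expectation_mul // K_diag.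
by rewrite integral_cst //= probability_setT mule1.
Qed.

Let X_sqr_prod_integrable :
  (P \x mu).-integrable setT (fun z : Om * T => (X z.1 z.2 ^+ 2)%:E).
Proof.
apply/integrable12ltyP; first exact/measurable_EFinP/measurable_funX.
rewrite [ltLHS](_ : _ = Lam%:E) ?ltry // -expectation_ip_self.
apply: eq_integral => w _; rewrite fineK; last first.
  exact: (integrable_fin_num measurableT (ip_integrable _ _)).
by apply: eq_integral => t _ /=; rewrite ger0_norm ?sqr_ge0 // expr2.
Qed.

Lemma ip_self_integrable : P.-integrable setT (fun w => (ip mu (X w) (X w))%:E).
Proof.
apply/integrableP; split.
  apply/measurable_EFinP; apply: measurableT_comp => //.
  apply: (measurable_fun_fubini_tonelli_F
    (fun z : Om * T => (X z.1 z.2 * X z.1 z.2)%:E)).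
    by apply/measurable_EFinP; exact: measurable_funM.
  by move=> z; rewrite lee_fin -expr2 sqr_ge0.
under eq_integral do rewrite gee0_abs ?lee_fin ?ip_ge0 //.
by rewrite expectation_ip_self ltry.
Qed.

Section eigenfunction.
Variables (phi : L2 mu) (c : R) (lam : R).
Hypotheses (phi_le : forall t, (`|phi t| <= c)%R).

Lemma X_phi_integrable :
  (P \x mu).-integrable setT (fun z : Om * T => (X z.1 z.2 * phi z.2)%:E).
Proof.
have i1 : (P \x mu).-integrable setT (fun z : Om * T => ((1 : R) ^+ 2)%:E).
  exact: (integrable_fst
    (@finite_measure_integrable_cst _ _ _ P setT (1 ^+ 2)%R measurableT)).
have mphi : measurable_fun setT (fun z : Om * T => phi z.2).
  exact: measurableT_comp.
have := integrable_mul_bounded mX (@measurable_cst _ _ _ _ _ (1%R : R)) mphi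
  (fun z => phi_le z.2) X_sqr_prod_integrable i1.
by apply: eq_integrable => // z _; rewrite /= mulr1.
Qed.

Lemma measurable_ip_X : measurable_fun setT (fun w => ip mu (X w) phi).
Proof.
apply: measurableT_comp => //; exact: measurable_fubini_F X_phi_integrable.
Qed.

Lemma ip_X_sqr_integrable :
  P.-integrable setT (fun w => (ip mu (X w) phi ^+ 2)%:E).
Proof.
have := integrableZl measurableT (ip mu phi phi) ip_self_integrable.
apply: le_integrable => //.
  by apply/measurable_EFinP/measurable_funX; exact: measurable_ip_X.
move=> w _ /=; rewrite lee_fin [leRHS]ger0_norm ?mulr_ge0 ?ip_ge0 //.
rewrite normrX -(sqr_sqrtr (ip_ge0 phi)) -(sqr_sqrtr (ip_ge0 (X w))) -exprMn.
rewrite ler_pXn2r ?nnegrE ?mulr_ge0 ?sqrtr_ge0 // mulrC.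
exact: ip_CauchySchwarz.
Qed.

Hypothesis phi_eigen : forall t, D t ->
  \int[mu]_s (K t s * phi s)%:E = (lam * phi t)%:E.

Let Y w := ip mu (X w) phi.

(** Fubini turns the left-hand side into the integral of the covariance
    function against phi, to which the eigenfunction equation applies. *)
Lemma expectation_X_ip t : D t ->
  \int[P]_w (X w t * Y w)%:E = (lam * phi t)%:E.
Proof.
move=> Dt; pose f (z : Om * T) := (X z.1 t * X z.1 z.2 * phi z.2)%:E.
have fi : (P \x mu).-integrable setT f.
  apply: (integrable_mul_bounded _ mX _ (fun z => phi_le z.2)) => //.
  - exact: (measurableT_comp (mXt t)).
  - exact: measurableT_comp.
  - by have := integrable_fst (X_sqr_integrable Dt).
transitivity (\int[P]_w \int[mu]_s f (w, s)).
  apply: eq_integral => w _; rewrite /f /=.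
  under eq_integral do rewrite -mulrA EFinM.
  rewrite integralZl //; last exact: ip_integrable.
  rewrite EFinM; congr (_ * _); rewrite fineK //.
  exact: (integrable_fin_num measurableT (ip_integrable _ _)).
rewrite Fubini // -phi_eigen //; apply: ae_eq_integral => //.
- exact: measurable_fubini_G fi.
- by apply/measurable_EFinP/measurable_funM => //; exact: mK.
apply: ae_in_D => s Ds; rewrite /f /=.
under eq_integral do rewrite mulrC EFinM.
rewrite integralZl //.
  by rewrite expectation_mul // -EFinM mulrC.
exact: (integrable_mul_sqr (mXt t) (mXt s)
  (X_sqr_integrable Dt) (X_sqr_integrable Ds)).
Qed.

(** A second use of Fubini: integrating the preceding identity against psi
    gives the covariance of two coordinates of the field. *)
Lemma expectation_ip_mul (psi : L2 mu) (b : R) : (forall t, `|psi t| <= b)%R ->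
  \int[P]_w (ip mu (X w) psi * Y w)%:E = (lam * ip mu phi psi)%:E.
Proof.
move=> psi_le; pose f (z : Om * T) := (X z.1 z.2 * Y z.1 * psi z.2)%:E.
have fi : (P \x mu).-integrable setT f.
  apply: (integrable_mul_bounded mX _ _ (fun z => psi_le z.2)) => //.
  - exact: (measurableT_comp measurable_ip_X).
  - exact: measurableT_comp.
  - by have := integrable_fst ip_X_sqr_integrable.
transitivity (\int[P]_w \int[mu]_s f (w, s)).
  apply: eq_integral => w _; rewrite /f /=.
  under eq_integral do rewrite mulrAC mulrC EFinM.
  rewrite integralZl //; last exact: ip_integrable.
  rewrite mulrC EFinM; congr (_ * _); rewrite fineK //.
  exact: (integrable_fin_num measurableT (ip_integrable _ _)).
rewrite Fubini //.
transitivity (\int[mu]_t (lam * (phi t * psi t))%:E).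
  apply: ae_eq_integral => //.
  - exact: measurable_fubini_G fi.
  - by apply/measurable_EFinP; do ! apply: measurable_funM => //.
  apply: ae_in_D => t Dt; rewrite /f /=.
  under eq_integral do rewrite mulrC EFinM.
  rewrite integralZl //.
    by rewrite expectation_X_ip // -EFinM; congr EFin; ring.
  exact: (integrable_mul_sqr (mXt t) measurable_ip_X
    (X_sqr_integrable Dt) ip_X_sqr_integrable).
under eq_integral do rewrite EFinM.
rewrite integralZl //; last exact: ip_integrable.
rewrite EFinM; congr (_ * _); rewrite fineK //.
exact: (integrable_fin_num measurableT (ip_integrable _ _)).
Qed.

End eigenfunction.
End random_field.

(** * Average case errors *)

Section approximation_error.
Context {disp disp' : measure_display} {T : measurableType disp}
  {Om : measurableType disp'} {R : realType}.
Variables (mu : probability T R) (P : probability Om R).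
Variable X : Om -> L2 mu.
Local Open Scope ereal_scope.

(** The integral of a nonnegative function is a supremum over the simple
    functions below it. In this form monotonicity applies to the error of an
    arbitrary approximation as a function of the sample, whose measurability
    would require a representation of the functionals. *)
Lemma ge0_le_integral_nonmeasurable d (S : measurableType d)
    (m : {measure set S -> \bar R}) (f h : S -> \bar R) :
  (forall x, 0 <= f x) -> (forall x, f x <= h x) ->
  \int[m]_x f x <= \int[m]_x h x.
Proof.
move=> f0 fh; have h0 x : 0 <= h x by exact: le_trans (fh x).
rewrite !ge0_integralTE //; apply: le_ereal_sup => _ [g gf <-].
by exists g => // x; exact: le_trans (fh x).
Qed.

(** Packages an inner product as one of the linear functionals used by the
    approximations. *)
Lemma ip_scalar_exists (phi : L2 mu) :
  exists l : {scalar L2 mu}, forall f, l f = ip mu f phi.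
Proof.
have lin : GRing.linear_for *%R (fun f : L2 mu => ip mu f phi).
  by move=> a f g; rewrite ipDl ipZl.
pose M := GRing.isLinear.Build R (L2 mu) R *%R (fun f : L2 mu => ip mu f phi) lin.
pose l : {scalar L2 mu} := HB.pack (fun f : L2 mu => ip mu f phi) M.
by exists l.
Qed.

Lemma mean_square_errorE n (l : 'I_n -> {scalar L2 mu}) (psi : 'I_n -> L2 mu) :
  mean_square_error P X l psi =
  (\int[P]_w (let h := (X w - \sum_(m < n) l m (X w) *: psi m)%R in
     (ip mu h h)%:E)) `^ 2^-1.
Proof. by congr (_ `^ _); apply: eq_integral => w _; rewrite L2norm_sqr. Qed.

Lemma poweR_half (x : R) : (0 <= x)%R -> x%:E `^ 2^-1 = (Num.sqrt x)%:E.
Proof. by move=> x0; rewrite poweR_EFin powR12_sqrt. Qed.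

Variables (D : set T) (K : T -> T -> R) (Lam : R).
Hypotheses (HX : zero_mean_field P D K X) (mD : measurable D)
  (muD : mu (~` D) = 0) (K_diag : forall t, D t -> K t t = Lam)
  (mK : forall t, measurable_fun setT (K t)).

Lemma kernel_diag_ge0 : (0 <= Lam)%R.
Proof.
rewrite -lee_fin -(expectation_ip_self HX mD muD K_diag).
by apply: integral_ge0 => w _; rewrite lee_fin ip_ge0.
Qed.

Lemma avg_error0 : avg_error P X 0 = (Num.sqrt Lam)%:E.
Proof.
have mse0 (l : 'I_0 -> {scalar L2 mu}) psi :
    mean_square_error P X l psi = (Num.sqrt Lam)%:E.
  rewrite mean_square_errorE -poweR_half ?kernel_diag_ge0 //.
  rewrite -(expectation_ip_self HX mD muD K_diag).
  by congr (_ `^ _); apply: eq_integral => w _; rewrite big_ord0 subr0.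
rewrite /avg_error (_ : [set e | _] = [set (Num.sqrt Lam)%:E]) ?ereal_inf1 //.
apply/seteqP; split=> [_ [l [psi [_ ->]]]|_ ->]; first exact: mse0.
have [l _] := ip_scalar_exists 0%R.
exists (fun=> l), (fun=> 0%R); split=> [[]//|]; by rewrite mse0.
Qed.

Section eigenfamily.
Variables (N : nat) (phi : 'I_N -> L2 mu) (lam : 'I_N -> R) (c : R).
Hypotheses (phi_le : forall k t, (`|phi k t| <= c)%R)
  (phi_orth : forall k l, ip mu (phi k) (phi l) = (k == l)%:R)
  (phi_eigen : forall k t, D t ->
    \int[mu]_s (K t s * phi k s)%:E = (lam k * phi k t)%:E).

Let xi w k := ip mu (X w) (phi k).

Let xi_mul_integrable k l :
  P.-integrable setT (fun w => (xi w k * xi w l)%:E).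
Proof.
apply: integrable_mul_sqr.
- exact: (measurable_ip_X HX mD muD K_diag (phi_le k)).
- exact: (measurable_ip_X HX mD muD K_diag (phi_le l)).
- exact: (ip_X_sqr_integrable HX mD muD K_diag (phi_le k)).
- exact: (ip_X_sqr_integrable HX mD muD K_diag (phi_le l)).
Qed.

Lemma expectation_coordinates k l :
  \int[P]_w (xi w k * xi w l)%:E = (lam k * (k == l)%:R)%:E.
Proof.
rewrite (expectation_ip_mul HX mD muD K_diag mK (phi_le l)
  (phi_eigen l) (phi_le k)) phi_orth eq_sym.
by case: eqVneq => [->|]; rewrite ?mulr0.
Qed.

(** Uncorrelated coordinates: only the diagonal of M contributes. *)
Lemma expectation_quadratic (M : 'I_N -> 'I_N -> R) :
  P.-integrable setT (fun w => (\sum_k \sum_l xi w k * xi w l * M k l)%:E) /\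
  \int[P]_w (\sum_k \sum_l xi w k * xi w l * M k l)%:E =
    (\sum_k lam k * M k k)%:E.
Proof.
have E : (fun w => (\sum_k \sum_l xi w k * xi w l * M k l)%:E) =
    (fun w => \sum_k \sum_l (M k l)%:E * (xi w k * xi w l)%:E).
  apply/funext => w; rewrite -sumEFin; apply: eq_bigr => k _.
  by rewrite -sumEFin; apply: eq_bigr => l _; rewrite -EFinM mulrC.
have int1 k l : P.-integrable setT (fun w => (M k l)%:E * (xi w k * xi w l)%:E).
  exact: integrableZl (xi_mul_integrable k l).
have int2 k : P.-integrable setT
    (fun w => \sum_l (M k l)%:E * (xi w k * xi w l)%:E).
  exact: integrable_sum.
rewrite E; split; first exact: integrable_sum.
rewrite integral_sum // -sumEFin; apply: eq_bigr => k _.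
rewrite integral_sum // (bigD1 k) //= big1 ?adde0 => [|l /negbTE lk].
  by rewrite integralZl // expectation_coordinates eqxx mulr1 -EFinM mulrC.
by rewrite integralZl // expectation_coordinates eq_sym lk mulr0 mule0.
Qed.

(** The orthogonal expansion along the family is an admissible
    approximation, and its residual is computed by Pythagoras. *)
Lemma avg_error_le :
  avg_error P X N <= (Num.sqrt (Lam - \sum_k lam k))%:E.
Proof.
have /choice[l lE] k := ip_scalar_exists (phi k).
apply: ereal_inf_lbound; exists l, phi; split.
  by move=> k; rewrite /L2_continuous => f e e0; have [del del0 lc] :=
    ip_continuous (phi k) f e0; exists del => // h /lc; rewrite !lE.
have [qint qE] := expectation_quadratic (fun k l => (k == l)%:R).
have qxi w : (\sum_k \sum_l xi w k * xi w l * (k == l)%:R)%R =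
    (\sum_k xi w k ^+ 2)%R.
  apply: eq_bigr => k _; rewrite (bigD1 k) //= eqxx mulr1 big1 ?addr0 //.
  by move=> j /negbTE jk; rewrite eq_sym jk mulr0.
have E : \int[P]_w (ip mu (X w) (X w) - \sum_k xi w k ^+ 2)%:E =
         (Lam - \sum_k lam k)%:E.
  under eq_integral do rewrite EFinB -qxi.
  rewrite integralB //; last exact: (ip_self_integrable HX mD muD K_diag).
  rewrite (expectation_ip_self HX mD muD K_diag) qE -EFinB; congr (_ - _)%:E.
  by apply: eq_bigr => k _; rewrite eqxx mulr1.
rewrite mean_square_errorE -poweR_half.
  congr (_ `^ _); rewrite -E; apply: eq_integral => w _ /=.
  rewrite (eq_bigr (fun k => (xi w k *: phi k)%R)) => [|k _]; last by rewrite lE.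
  by rewrite (ip_residual phi_orth).
rewrite -lee_fin -E; apply: integral_ge0 => w _.
by rewrite lee_fin subr_ge0 bessel.
Qed.

(** An approximation of rank n has its coordinates in the row space of
    the matrix A of inner products of the psi m with the eigenfunctions. By
    Bessel the squared error is at least the squared distance of the coordinate
    vector to this space, and the p k are the diagonal entries of the
    projection on it. *)
Lemma avg_error_lt n (b : R) : (0 <= b)%R ->
  avg_error P X n < (Num.sqrt b)%:E ->
  exists p : 'I_N -> R, [/\ forall k, (0 <= p k <= 1)%R,
    (\sum_k p k <= n%:R)%R & (\sum_k lam k * (1 - p k) <= b)%R].
Proof.
move=> b0 /ereal_inf_lt[_ [l [psi [_ ->]]]].
pose A : 'M[R]_(n, N) := \matrix_(m, k) ip mu (psi m) (phi k).
have [Q [QT QQ AQ Qtr]] := orthogonal_projection_exists A.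
rewrite mean_square_errorE; set I := \int[P]_w _ => err.
have I0 : 0 <= I by apply: integral_ge0 => w _; rewrite lee_fin; exact: ip_ge0.
exists (fun k => Q k k); split; [exact: projection_diag|exact: Qtr|].
have [qint qE] := expectation_quadratic (fun k l => ((k == l)%:R - Q k l)%R).
set S := (\sum_k _)%R.
have SE : (\sum_k lam k * ((k == k)%:R - Q k k))%R = S.
  by apply: eq_bigr => k _; rewrite eqxx.
pose x w : 'rV[R]_N := \row_k xi w k.
have xE w : (\sum_k \sum_j xi w k * xi w j * ((k == j)%:R - Q k j))%R =
    sqnorm (x w *m (1%:M - Q)).
  rewrite sqnorm_residual //; apply: eq_bigr => k _; apply: eq_bigr => j _.
  by rewrite !mxE.
have S0 : (0 <= S)%R.
  rewrite -SE -lee_fin -qE; apply: integral_ge0 => w _.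
  by rewrite lee_fin xE sqnorm_ge0.
have : (Num.sqrt S)%:E < (Num.sqrt b)%:E.
  apply: le_lt_trans err; rewrite -poweR_half //.
  apply: gt0_ler_poweR => //.
  - by rewrite in_itv /= leey lee_fin S0.
  - by rewrite in_itv /= leey I0.
  rewrite -SE -qE; apply: ge0_le_integral_nonmeasurable => w.
    by rewrite lee_fin xE sqnorm_ge0.
  rewrite lee_fin xE; set h := (X w - _)%R.
  (* The error is seen only through its coordinates along the family. *)
  apply: le_trans (bessel phi_orth h).
  pose a : 'rV[R]_n := \row_m l m (X w).
  have -> : (\sum_k ip mu h (phi k) ^+ 2)%R = sqnorm (x w - a *m A).
    apply: eq_bigr => k _; rewrite /h ipBl ip_suml !mxE; congr ((_ - _) ^+ 2)%R.
    by apply: eq_bigr => m _; rewrite ipZl !mxE.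
  by apply: sqnorm_residual_le => //; rewrite -mulmxA AQ.
rewrite lte_fin => Sb; rewrite leNgt; apply/negP => /ltW bS.
by move: Sb; rewrite ltNge ler_wsqrtr.
Qed.

End eigenfamily.
End approximation_error.

(** * Bounded measurable functions and trigonometric integrals *)

Section bounded_measurable.
Context {d : measure_display} {T : measurableType d} {R : realType}.

(** A class of functions that is closed under sums and products and
    integrable for every probability, to discharge integrability conditions. *)
Definition bounded_measurable (f : T -> R) :=
  measurable_fun setT f /\ exists c : R, forall x, `|f x| <= c.

Lemma bounded_measurable_cst (a : R) : bounded_measurable (fun=> a).
Proof. by split=> //; exists `|a|. Qed.

Lemma bounded_measurableM (f h : T -> R) : bounded_measurable f ->
  bounded_measurable h -> bounded_measurable (fun x => f x * h x).
Proof.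
move=> [mf [c fc]] [mh [b hb]]; split; first exact: measurable_funM.
by exists (c * b) => x; rewrite normrM ler_pM.
Qed.

Lemma bounded_measurableD (f h : T -> R) : bounded_measurable f ->
  bounded_measurable h -> bounded_measurable (fun x => f x + h x).
Proof.
move=> [mf [c fc]] [mh [b hb]]; split; first exact: measurable_funD.
by exists (c + b) => x; rewrite (le_trans (ler_normD _ _)) // lerD.
Qed.

Lemma bounded_measurable_sum I (s : seq I) (F : I -> T -> R) :
  (forall i, bounded_measurable (F i)) ->
  bounded_measurable (fun x => \sum_(i <- s) F i x).
Proof.
move=> bF; elim: s => [|i s IH].
  under eq_fun do rewrite big_nil; exact: bounded_measurable_cst.
under eq_fun do rewrite big_cons; exact: bounded_measurableD.
Qed.

Lemma bounded_measurable_prod I (s : seq I) (F : I -> T -> R) :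
  (forall i, bounded_measurable (F i)) ->
  bounded_measurable (fun x => \prod_(i <- s) F i x).
Proof.
move=> bF; elim: s => [|i s IH].
  under eq_fun do rewrite big_nil; exact: bounded_measurable_cst.
under eq_fun do rewrite big_cons; exact: bounded_measurableM.
Qed.

Lemma bounded_measurable_comp d' (S : measurableType d') (p : S -> T)
    (f : T -> R) : measurable_fun setT p -> bounded_measurable f ->
  measurable_fun setT (f \o p) /\ exists c : R, forall x, `|f (p x)| <= c.
Proof.
move=> mp [mf [c fc]]; split; first exact: measurableT_comp.
by exists c => x; exact: fc.
Qed.

Lemma bounded_measurable_integrable (m : probability T R) (f : T -> R) :
  bounded_measurable f -> m.-integrable setT (EFin \o f).
Proof.
move=> [mf [c fc]]; apply: measurable_bounded_integrable => //.
  by rewrite (le_lt_trans (probability_le1 _ _)) // ltry.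
exists c; split; first exact: num_real.
by move=> x cx y _; exact: (le_trans (fc y) (ltW cx)).
Qed.

Lemma bounded_measurable_EFin (m : probability T R) (f : T -> R) :
  bounded_measurable f -> (\int[m]_x (f x)%:E = (\int[m]_x f x)%R%:E)%E.
Proof.
move=> bf; rewrite /Rintegral fineK //.
exact: (integrable_fin_num measurableT (bounded_measurable_integrable m bf)).
Qed.

Lemma bounded_measurable_L2 (m : probability T R) (f : T -> R) :
  bounded_measurable f -> exists phi : L2 m, phi =1 f.
Proof.
move=> [mf [c fc]].
have f2 : f \in Lfun m 2%:E.
  rewrite inE; apply/andP; split; rewrite inE //=.
  rewrite /finite_norm unlock /Lnorm poweR_lty //.
  apply: (@le_lt_trans _ _ (\int[m]_x (cst (c ^+ 2)%:E x))%E).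
    apply: ge0_le_integral => //.
    - by move=> x _; exact: poweR_ge0.
    - apply/measurable_EFinP; apply: (measurableT_comp (measurable_powR _)).
      exact: measurableT_comp.
    - move=> x _ /=; rewrite lee_fin powR_mulrn //.
      by rewrite ler_pXn2r ?nnegrE ?normr_ge0 // (le_trans _ (fc x)).
  by rewrite integral_cst //= probability_setT mule1 ltry.
by exists (Lfun_Sub (lee1n 2) f2) => x.
Qed.

End bounded_measurable.

Section unit_interval.
Context {R : realType}.
Local Notation U := (uniform_prob (@ltr01 R)).

Lemma bounded_measurable_cosine (w c : R) :
  bounded_measurable (fun s : measurableTypeR R => cos (w * s + c)).
Proof.
split; last by exists 1 => x; exact: cos_max.
apply: continuous_measurable_fun => x.
apply: (@continuous_comp _ _ _ (fun s : R => w * s + c) cos).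
  by apply: cvgD; [apply: cvgMr; exact: cvg_id | exact: cvg_cst].
exact: continuous_cos.
Qed.

(** The sine primitive takes the same value at both ends. The constant 1 is
    added before integrating since the change from the uniform law to the
    Lebesgue measure is available for nonnegative functions. *)
Lemma integral_cosine (w c : R) : w != 0 -> sin (w + c) = sin c ->
  \int[U]_s cos (w * s + c) = 0.
Proof.
move=> w0 per.
(* The integrand is shifted to be nonnegative. *)
pose h (s : R) := 1 + cos (w * s + c).
pose H (s : R) := s + w^-1 * sin (w * s + c).
have bh : bounded_measurable (h : measurableTypeR R -> R).
  apply: bounded_measurableD; first exact: bounded_measurable_cst.
  exact: bounded_measurable_cosine.
have dH (s : R) : is_derive s 1 H (h s).
  rewrite /H /h; apply: is_derive_eq.
  by rewrite /GRing.scale /= mulr1 addr0 mulrCA mulVf // mulr1.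
have ch : continuous h.
  move=> s; apply: cvgD; first exact: cvg_cst.
  apply: (@continuous_comp _ _ _ (fun s : R => w * s + c) cos).
    by apply: cvgD; [apply: cvgMr; exact: cvg_id | exact: cvg_cst].
  exact: continuous_cos.
have cH : continuous H.
  by move=> s; apply: differentiable_continuous; apply/derivable1_diffP.
have int_h : (\int[U]_s (h s)%:E = 1)%E.
  rewrite integral_uniform; last 2 first.
  - by case: bh => mh _; exact/measurable_EFinP.
  - by move=> s; rewrite lee_fin /h; have := cos_geN1 (w * s + c); lra.
  rewrite subr0 invr1 mul1e (@continuous_FTC2 _ h H) //.
  - by rewrite /H -EFinB mulr1 mulr0 !add0r per addrK.
  - by apply: continuous_subspaceT.
  - split; [by move=> x _; exact: (@ex_derive _ _ _ _ _ _ _ (dH x))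
      | by apply: cvg_at_right_filter; exact: cH
      | by apply: cvg_at_left_filter; exact: cH].
  - by move=> x _; rewrite derive1E; exact: (@derive_val _ _ _ _ _ _ _ (dH x)).
have := int_h; rewrite (bounded_measurable_EFin _ bh).
rewrite RintegralD //; last 2 first.
- exact: bounded_measurable_integrable (bounded_measurable_cst _).
- exact: bounded_measurable_integrable (bounded_measurable_cosine _ _).
rewrite Rintegral_cst //= probability_setT /= mulr1 => -[].
by move=> /(canRL (addKr _)) ->; rewrite addNr.
Qed.
End unit_interval.

(** * The univariate Korobov kernel *)

Section zeta_sums.
Context {R : realType}.
Implicit Types a : R.

(** A discrete form of the primitive of x^-a: with y = k + 1 it follows from
    ln (1 - 1/y) <= - 1/y and exp x >= 1 + x. *)
Lemma powRN_telescope a k : 1 < a -> (0 < k)%N ->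
  (a - 1) * k.+1%:R `^ (- a) <= k%:R `^ (1 - a) - k.+1%:R `^ (1 - a).
Proof.
move=> a1 k0; have k0' : (0 : R) < k%:R by rewrite ltr0n.
have y0 : (0 : R) < k.+1%:R by rewrite ltr0n.
set y : R := k.+1%:R in y0 *.
have ky : k%:R = y - 1 by rewrite /y -natr1 addrK.
have yN0 : y != 0 by rewrite gt_eqF.
have kE : k%:R = y * (1 - y^-1) by rewrite mulrBr mulr1 divff // ky.
have lnk : ln k%:R <= ln y - y^-1.
  rewrite kE lnM ?posrE //; last by rewrite -(pmulr_rgt0 _ y0) -kE.
  rewrite lerD2l; apply: le_ln1Dx.
  by rewrite ltrN2 -invr1 ltf_pV2 ?posrE // /y ltr1n.
have -> : y `^ (- a) = y `^ (1 - a) * y^-1.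
  by rewrite -powR_inv1 ?ltW // -powRD ?yN0 ?implybT //; congr (_ `^ _); ring.
rewrite lerBrDr.
have -> : (a - 1) * (y `^ (1 - a) * y^-1) + y `^ (1 - a) =
    y `^ (1 - a) * (1 + (a - 1) * y^-1) by ring.
rewrite /powR !gt_eqF //.
apply: (@le_trans _ _ (expR ((1 - a) * ln y) * expR ((a - 1) * y^-1))).
  by rewrite ler_wpM2l ?expR_ge0 // expR_ge1Dx.
rewrite -expRD ler_expR.
have : (a - 1) * ln k%:R <= (a - 1) * (ln y - y^-1).
  by rewrite ler_wpM2l // subr_ge0 ltW.
by move: (ln y) (y^-1) (ln k%:R) => u v w; nra.
Qed.

(** Telescoping; a bound on the zeta function that is uniform in the length
    of the sum, and in a when a stays away from 1. *)
Lemma sum_powRN_le a n : 1 < a ->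
  \sum_(k < n) k.+1%:R `^ (- a) <= 1 + (a - 1)^-1.
Proof.
move=> a1; have a10 : 0 < a - 1 by rewrite subr_gt0.
case: n => [|n]; first by rewrite big_ord0 addr_ge0 // invr_ge0 ltW.
suff : \sum_(k < n.+1) k.+1%:R `^ (- a) <=
    1 + (a - 1)^-1 * (1 - n.+1%:R `^ (1 - a)).
  move=> /le_trans; apply; rewrite lerD2l ler_piMr // ?gerBl ?powR_ge0 //.
    by rewrite invr_ge0 ltW.
elim: n => [|n IH].
  by rewrite big_ord_recl big_ord0 !powR1 subrr mulr0 addr0.
rewrite big_ord_recr /= (le_trans (lerD IH (lexx _))) // -addrA lerD2l.
rewrite -(ler_pM2l a10) mulrDr !mulrA divff ?gt_eqF // !mul1r.
have := @powRN_telescope a n.+1 a1 isT.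
lra.
Qed.

End zeta_sums.

Section korobov.
Context {R : realType}.
Local Notation U := (uniform_prob (@ltr01 R)).
Implicit Types g r t s : R.

(** Sines are written as shifted cosines, up to sign, so that one
    product formula covers all cases. *)
Definition phase (b : bool) : R := if b then pi / 2 else 0.

(** The Fourier basis: [None] is the constant, [Some (k, b)] has frequency
    k + 1, and b selects the cosine or the sine. *)
Definition trig (o : option (nat * bool)) (s : R) : R :=
  if o is Some (k, b)
  then Num.sqrt 2 * cos (2 * pi * k.+1%:R * s + phase b) else 1.

Definition korobov_eigenvalue (g r : R) (o : option (nat * bool)) : R :=
  if o is Some (k, _) then g * k.+1%:R `^ (- (2 * r)) else 1.

Lemma sin_int_period (m : int) (c : R) : sin (2 * pi * m%:~R + c) = sin c.
Proof.
have perio n (x : R) : sin (x + 2 * pi * n%:R) = sin x.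
  by rewrite -(periodicn (@sinD2pi R) n x); congr sin; ring.
case: m => n; first by rewrite addrC perio.
rewrite NegzE -[LHS](perio n.+1); congr sin.
by rewrite mulrNz -pmulrn; ring.
Qed.

Lemma integral_cosine_int (m : int) (c : R) :
  \int[U]_s cos (2 * pi * m%:~R * s + c) = (m == 0)%:R * cos c.
Proof.
have [->|m0] := eqVneq m 0.
  under eq_Rintegral do rewrite mulr0 mul0r add0r.
  by rewrite Rintegral_cst //= probability_setT /= mulr1 mul1r.
rewrite mul0r integral_cosine ?sin_int_period //.
by rewrite !mulf_neq0 ?intr_eq0 ?pnatr_eq0 // gt_eqF // pi_gt0.
Qed.

(** Product-to-sum formula; the sum of the two frequencies never vanishes
    and the difference vanishes when k = l. *)
Lemma integral_cosine_mul (k l : nat) (a b : R) :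
  \int[U]_s (cos (2 * pi * k.+1%:R * s + a) * cos (2 * pi * l.+1%:R * s + b)) =
  (k == l)%:R / 2 * cos (a - b).
Proof.
pose m1 : int := k.+1%:Z - l.+1%:Z; pose m2 : int := k.+1%:Z + l.+1%:Z.
transitivity (\int[U]_s (2^-1 * (cos (2 * pi * m1%:~R * s + (a - b)) +
    cos (2 * pi * m2%:~R * s + (a + b))))).
  apply: eq_Rintegral => s _.
  set A := 2 * pi * _ * s + a; set B := 2 * pi * _ * s + b.
  have -> : 2 * pi * m1%:~R * s + (a - b) = A - B.
    by rewrite /A /B /m1 rmorphB /= -!pmulrn; ring.
  have -> : 2 * pi * m2%:~R * s + (a + b) = A + B.
    by rewrite /A /B /m2 rmorphD /= -!pmulrn; ring.
  by rewrite (cosB A B) (cosD A B); field.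
have bc m c := bounded_measurable_integrable U
  (bounded_measurable_cosine (2 * pi * m%:~R) c).
rewrite RintegralZl //; last first.
  by apply: bounded_measurable_integrable; apply: bounded_measurableD;
    exact: bounded_measurable_cosine.
rewrite RintegralD // !integral_cosine_int /m1 /m2 subr_eq0 eqz_nat eqSS.
rewrite -PoszD addSn /= mul0r addr0; ring.
Qed.

Lemma bounded_measurable_trig o :
  bounded_measurable (trig o : measurableTypeR R -> R).
Proof.
case: o => [[k b]|] /=; last exact: bounded_measurable_cst.
apply: (bounded_measurableM (bounded_measurable_cst _)).
exact: bounded_measurable_cosine.
Qed.

Lemma trig_norm_le o s : `|trig o s| <= 2.
Proof.
case: o => [[k b]|] /=; last by rewrite normr1 ler1n.
rewrite normrM -[2 in leRHS]mulr1 ler_pM ?normr_ge0 ?cos_max //.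
by rewrite ger0_norm ?sqrtr_ge0 // -(@ler_pXn2r _ 2) ?nnegrE ?sqrtr_ge0 //
  sqr_sqrtr // expr2 ler_peMl // ler1n.
Qed.

Lemma trig_orthonormal o o' : \int[U]_s (trig o s * trig o' s) = (o == o')%:R.
Proof.
have s2 : Num.sqrt 2 * Num.sqrt 2 = 2 :> R by rewrite -expr2 sqr_sqrtr.
have trig0 k b : \int[U]_s trig (Some (k, b)) s = 0.
  rewrite /= RintegralZl //; last first.
    exact: bounded_measurable_integrable (bounded_measurable_cosine _ _).
  by have := integral_cosine_int k.+1 (phase b); rewrite pmulrn => ->;
    rewrite mul0r mulr0.
case: o o' => [[k b]|] [[l c]|].
- transitivity (2 * \int[U]_s (cos (2 * pi * k.+1%:R * s + phase b) *
      cos (2 * pi * l.+1%:R * s + phase c))).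
    rewrite -RintegralZl //; last first.
      by apply: bounded_measurable_integrable; apply: bounded_measurableM;
        exact: bounded_measurable_cosine.
    by apply: eq_Rintegral => s _; rewrite /= mulrACA s2.
  rewrite integral_cosine_mul mulrA mulrCA divff // mulr1.
  rewrite (_ : Some (k, b) == Some (l, c) = (k == l) && (b == c)) //.
  case: (k == l); rewrite ?mul0r // mul1r /phase.
  by case: b c => [] [] /=; rewrite ?subrr ?subr0 ?sub0r ?cosN ?cos0 ?cos_pihalf.
- by under eq_Rintegral do rewrite mulr1; rewrite trig0.
- by under eq_Rintegral do rewrite mul1r; rewrite trig0.
- under eq_Rintegral do rewrite mulr1.
  by rewrite Rintegral_cst //= probability_setT /= mulr1.
Qed.

Definition korobov_partial (g r : R) (n : nat) (t s : R) : R :=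
  1 + 2 * g * \sum_(k < n)
    (k.+1%:R `^ (- (2 * r)) * cos (2 * pi * k.+1%:R * (t - s))).

Let zeta_bound (r : R) := 1 + (2 * r - 1)^-1.

Lemma korobov_series_le r n t s : 2^-1 < r ->
  \sum_(k < n) `|k.+1%:R `^ (- (2 * r)) * cos (2 * pi * k.+1%:R * (t - s))| <=
  zeta_bound r.
Proof.
move=> r2; have r1 : 1 < 2 * r by lra.
apply: le_trans (sum_powRN_le n r1); apply: ler_sum => k _.
by rewrite normrM ger0_norm ?powR_ge0 // ler_piMr ?powR_ge0 ?cos_max.
Qed.

(** The series of the kernel starts at 1 whereas partial sums here are indexed
    from 0, hence the shift of the sequence. *)
Lemma korobov_partial_cvg g r t s : 2^-1 < r ->
  korobov_partial g r n t s @[n --> \oo] --> korobov_kernel g r t s.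
Proof.
move=> r2.
pose F k : R := k%:R `^ (- (2 * r)) * cos (2 * pi * k%:R * (t - s)).
pose u k := F k.+1.
have cvu : cvgn (series u).
  apply: normed_cvg; apply: nondecreasing_is_cvgn.
    by apply: nondecreasing_series => n _ _; exact: normr_ge0.
  exists (zeta_bound r) => _ [n _ <-]; rewrite /= /series /= big_mkord.
  exact: korobov_series_le.
have lim1 : limn (fun n => \sum_(1 <= k < n) F k) = limn (series u).
  apply/cvg_lim => //; rewrite -cvg_shiftS /=.
  under eq_fun do rewrite big_add1 /=.
  exact: cvu.
have -> : korobov_kernel g r t s = 1 + 2 * g * limn (series u).
  by rewrite /korobov_kernel -lim1.
apply: cvgD; first exact: cvg_cst.
apply: cvgMr.
have -> : (fun n => \sum_(k < n) (k.+1%:R `^ (- (2 * r)) *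
    cos (2 * pi * k.+1%:R * (t - s)))) = series u.
  by apply/funext => n; rewrite /series /= big_mkord.
exact: cvu.
Qed.

Lemma korobov_partial_le g r n t s : 2^-1 < r ->
  `|korobov_partial g r n t s| <= 1 + 2 * `|g| * zeta_bound r.
Proof.
move=> r2; rewrite (le_trans (ler_normD _ _)) // normr1 lerD2l !normrM.
rewrite (ger0_norm (ler0n _ 2)) ler_wpM2l ?mulr_ge0 //.
by rewrite (le_trans (ler_norm_sum _ _ _)) // korobov_series_le.
Qed.

Lemma korobov_kernel_le g r t s : 2^-1 < r ->
  `|korobov_kernel g r t s| <= 1 + 2 * `|g| * zeta_bound r.
Proof.
move=> r2; have cv : `|korobov_partial g r n t s| @[n --> \oo] -->
    `|korobov_kernel g r t s| by apply: cvg_norm; exact: korobov_partial_cvg.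
rewrite -(cvg_lim _ cv) //; apply: limr_le.
  by apply/cvg_ex; exists `|korobov_kernel g r t s|.
by near=> n; exact: korobov_partial_le.
Unshelve. all: by end_near.
Qed.

Lemma bounded_measurable_korobov_partial g r n t :
  bounded_measurable (korobov_partial g r n t : measurableTypeR R -> R).
Proof.
apply: bounded_measurableD; first exact: bounded_measurable_cst.
apply: bounded_measurableM; first exact: bounded_measurable_cst.
apply: bounded_measurable_sum => k.
apply: bounded_measurableM; first exact: bounded_measurable_cst.
under eq_fun => s do rewrite mulrBr addrC -mulNr.
exact: bounded_measurable_cosine.
Qed.

Lemma bounded_measurable_korobov_kernel g r t : 2^-1 < r ->
  bounded_measurable (korobov_kernel g r t : measurableTypeR R -> R).
Proof.
move=> r2; split; last by eexists => s; exact: korobov_kernel_le.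
apply: (@measurable_fun_cvg _ _ _ _ (fun n => korobov_partial g r n t)).
- by move=> n; case: (bounded_measurable_korobov_partial g r n t).
- by move=> s _; exact: korobov_partial_cvg.
Qed.

(** A partial sum that contains the frequency of the basis function already
    has the right eigenvalue. *)
Lemma integral_korobov_partial g r n t (o : option (nat * bool)) :
  (if o is Some (k, _) then (k < n)%N else true) ->
  \int[U]_s (korobov_partial g r n t s * trig o s) =
  korobov_eigenvalue g r o * trig o t.
Proof.
move=> on; pose c k : R := 2 * g * k.+1%:R `^ (- (2 * r)).
pose e k s : R := cos (2 * pi * k.+1%:R * s + - (2 * pi * k.+1%:R * t)).
have eb (k : nat) : bounded_measurable (fun s : measurableTypeR R =>
    c k * (e k s * trig o s)).
  apply: bounded_measurableM; first exact: bounded_measurable_cst.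
  apply: bounded_measurableM; last exact: bounded_measurable_trig.
  exact: bounded_measurable_cosine.
have eb' (k : nat) : bounded_measurable (fun s : measurableTypeR R =>
    e k s * trig o s).
  apply: bounded_measurableM; last exact: bounded_measurable_trig.
  exact: bounded_measurable_cosine.
transitivity (\int[U]_s (trig o s + \sum_(k < n) c k * (e k s * trig o s))).
  apply: eq_Rintegral => s _; rewrite mulrDl mul1r; congr (_ + _).
  rewrite mulr_sumr mulr_suml; apply: eq_bigr => k _.
  rewrite /c /e -cosN; have -> : - (2 * pi * k.+1%:R * (t - s)) =
    2 * pi * k.+1%:R * s + - (2 * pi * k.+1%:R * t) by ring.
  by rewrite !mulrA.
rewrite RintegralD //; last 2 first.
- exact: bounded_measurable_integrable (bounded_measurable_trig o).
- apply: bounded_measurable_integrable.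
  exact: (bounded_measurable_sum _ (fun k : 'I_n => eb k)).
have -> : \int[U]_s (\sum_(k < n) c k * (e k s * trig o s)) =
    \sum_(k < n) c k * \int[U]_s (e k s * trig o s).
  apply: EFin_inj; rewrite -bounded_measurable_EFin; last first.
    exact: (bounded_measurable_sum _ (fun k : 'I_n => eb k)).
  under eq_integral do rewrite -sumEFin.
  rewrite integral_sum //; last first.
    by move=> k; exact: bounded_measurable_integrable (eb k).
  rewrite -sumEFin; apply: eq_bigr => k _.
  rewrite bounded_measurable_EFin // RintegralZl //.
  exact: bounded_measurable_integrable (eb' k).
have -> : \int[U]_s trig o s = (o == None)%:R.
  rewrite -trig_orthonormal; apply: eq_Rintegral => s _.
  by rewrite [trig None s]/= mulr1.
case: o on {eb eb'} => [[k b] kn|_].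
  rewrite add0r (bigD1 (Ordinal kn)) //= big1 ?addr0 => [|l /negbTE lk].
    under eq_Rintegral do rewrite mulrCA.
    rewrite RintegralZl //; last first.
      by apply: bounded_measurable_integrable; apply: bounded_measurableM;
        exact: bounded_measurable_cosine.
    rewrite integral_cosine_mul eqxx -[cos (- _ - _)]cosN.
    rewrite (_ : - (_ - _) = 2 * pi * k.+1%:R * t + phase b); last by ring.
    by rewrite /c (_ : true%:R = 1) //; field.
  under eq_Rintegral do rewrite /= mulrCA.
  rewrite RintegralZl //; last first.
    by apply: bounded_measurable_integrable; apply: bounded_measurableM;
      exact: bounded_measurable_cosine.
  rewrite integral_cosine_mul (_ : (l == k :> nat) = false) ?mul0r ?mulr0 //.
rewrite big1 ?addr0 ?mulr1 // => k _ /=.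
under eq_Rintegral do rewrite mulr1.
by have := integral_cosine_int k.+1 (- (2 * pi * k.+1%:R * t));
  rewrite pmulrn => ->; rewrite mul0r mulr0.
Qed.

(** Dominated convergence along partial sums, which are uniformly bounded
    and whose integrals are eventually constant. *)
Lemma integral_korobov_kernel g r t o : 2^-1 < r ->
  \int[U]_s (korobov_kernel g r t s * trig o s) =
  korobov_eigenvalue g r o * trig o t.
Proof.
move=> r2; apply: EFin_inj.
have bt := bounded_measurable_trig o.
have bK := bounded_measurable_korobov_kernel g t r2.
have bKn n := bounded_measurable_korobov_partial g r n t.
rewrite -bounded_measurable_EFin; last exact: bounded_measurableM.
have [N oN] : exists N, forall n, (N <= n)%N ->
    if o is Some (k, _) then (k < n)%N else true.
  by case: (o) => [[k b]|]; [exists k.+1 | exists 0%N].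
set M := 1 + 2 * `|g| * zeta_bound r.
have [] := @dominated_convergence _ _ _ U setT measurableT
  (fun n s => (korobov_partial g r n t s * trig o s)%:E)
  (fun s => (korobov_kernel g r t s * trig o s)%:E) (cst (M * 2)%:E).
- by move=> n; have [m _] := bounded_measurableM (bKn n) bt; exact/measurable_EFinP.
- by have [m _] := bounded_measurableM bK bt; exact/measurable_EFinP.
- apply: aeW => s _; apply: cvg_EFin; first by near=> n.
  by apply: cvgM; [exact: korobov_partial_cvg|exact: cvg_cst].
- exact: (@finite_measure_integrable_cst _ _ _ U setT (M * 2) measurableT).
- apply: aeW => s n _; rewrite lee_fin normrM.
  by rewrite ler_pM ?normr_ge0 ?korobov_partial_le ?trig_norm_le.
move=> _ _ /= /cvg_lim <- //; apply: lim_near_cst => //.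
near=> n; rewrite bounded_measurable_EFin; last exact: bounded_measurableM.
rewrite integral_korobov_partial //; apply: oN.
by near: n; exact: nbhs_infty_ge.
Unshelve. all: by end_near.
Qed.

End korobov.

(** * Tensor products over the cube *)

Section cube.
Context {R : realType}.
Local Notation U := (uniform_prob (@ltr01 R)).

Lemma bounded_measurable_tprod d (f : 'I_d -> measurableTypeR R -> R) :
  (forall j, bounded_measurable (f j)) ->
  bounded_measurable (fun t : d.-tuple (measurableTypeR R) =>
    \prod_(j < d) f j (tnth t j)).
Proof.
move=> bf; apply: bounded_measurable_prod => j.
exact: (bounded_measurable_comp (measurable_tnth j) (bf j)).
Qed.

(** The one integration formula needed on the cube: independence of the
    coordinates, by Fubini and induction on the dimension. *)
Lemma integral_cube_prod d (f : 'I_d -> measurableTypeR R -> R) :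
  (forall j, bounded_measurable (f j)) ->
  \int[cube_measure d]_t (\prod_(j < d) f j (tnth t j)) =
  \prod_(j < d) \int[U]_s f j s.
Proof.
elim: d f => [|d IH] f bf.
  under eq_Rintegral do rewrite big_ord0.
  rewrite big_ord0 Rintegral_cst // mul1r.
  exact: (congr1 fine (probability_setT (@cube_measure R 0))).
have bp := bounded_measurable_tprod bf.
pose f' (j : 'I_d) := f (lift ord0 j).
have bp' : bounded_measurable (fun t : d.-tuple (measurableTypeR R) =>
    \prod_(j < d) f' j (tnth t j)).
  by apply: bounded_measurable_tprod => j; exact: bf.
have tconsE (z : measurableTypeR R * d.-tuple R) :
    \prod_(j < d.+1) f j (tnth (tcons z) j) =
    f ord0 z.1 * \prod_(j < d) f' j (tnth z.2 j).
  rewrite big_ord_recl; congr (_ * _); apply: eq_bigr => j _.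
  by rewrite /f' [tcons z]/= tnthS.
apply: EFin_inj; rewrite -bounded_measurable_EFin //=.
have bz : bounded_measurable (fun z : measurableTypeR R * d.-tuple R =>
    f ord0 z.1 * \prod_(j < d) f' j (tnth z.2 j)).
  apply: bounded_measurableM.
    exact: (bounded_measurable_comp measurable_fst (bf ord0)).
  exact: (bounded_measurable_comp measurable_snd bp').
have iz := bounded_measurable_integrable (U \x cube_measure d)%E bz.
rewrite integral_distribution; last 2 first.
- by case: bp => mp _; exact/measurable_EFinP.
- by apply: eq_integrable iz => // z _; rewrite /= tconsE.
under eq_integral do rewrite /= tconsE.
rewrite -(integral12_prod_meas1 iz) /fubini_F.
transitivity (\int[U]_s (f ord0 s * \prod_(j < d) \int[U]_s f' j s)%:E)%E.
  apply: eq_integral => s _ /=.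
  under eq_integral do rewrite EFinM.
  rewrite integralZl //; last first.
    by have := bounded_measurable_integrable (cube_measure d) bp'.
  have /= -> := bounded_measurable_EFin (cube_measure d) bp'.
  by rewrite IH // => j; exact: bf.
rewrite bounded_measurable_EFin; last first.
  by apply: bounded_measurableM; [exact: bf | exact: bounded_measurable_cst].
rewrite RintegralZr //; last exact: bounded_measurable_integrable (bf _).
by rewrite big_ord_recl.
Qed.

Lemma measurable_unit_cube d : measurable (@unit_cube R d).
Proof.
have -> : @unit_cube R d = \bigcap_(j in [set: 'I_d])
    ((fun t : d.-tuple (measurableTypeR R) => tnth t j) @^-1` `[0, 1]).
  by apply/seteqP; split=> t /= t01 j; have := t01 j; rewrite /= in_itv /=;
    [move=> h _ | apply].
apply: fin_bigcap_measurable => [|j _]; first exact: finite_finset.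
by rewrite -[X in measurable X]setTI; exact: measurable_tnth.
Qed.

(** The indicator of the cube is a product of indicators of the unit
    interval. *)
Lemma cube_measure_unit_cube d : cube_measure d (~` @unit_cube R d) = 0%E.
Proof.
have bI : bounded_measurable (\1_`[0, 1] : measurableTypeR R -> R).
  split; first exact: measurable_indic.
  by exists 1 => x; rewrite indicE; case: (_ \in _); rewrite ?normr1 ?normr0.
have UI : \int[U]_s (\1_`[0, 1] s : R) = 1.
  rewrite /Rintegral integral_indic // setIT.
  by rewrite /= /uniform_prob integral_uniform_pdf1.
have cI : (\int[cube_measure d]_t (\1_(@unit_cube R d) t)%:E = 1)%E.
  have p1 : \int[cube_measure d]_t
      (\prod_(j < d) \1_`[0, 1] (tnth t j) : R) = 1.
    by rewrite (integral_cube_prod (fun _ : 'I_d => bI)) big1.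
  have bt := bounded_measurable_tprod (fun _ : 'I_d => bI).
  have := bounded_measurable_EFin (cube_measure d) bt; rewrite p1 => <-.
  apply: eq_integral => t _; congr EFin; rewrite indicE.
  have [t01|/negP nt01] := boolP (t \in _).
    rewrite big1 // => j _; rewrite indicE mem_set //=.
    by move: t01; rewrite inE => /(_ j); rewrite in_itv.
  apply/esym/eqP; rewrite prodf_seq_eq0; apply/hasP; apply: contrapT => nj.
  apply: nt01; rewrite inE => j; apply: contrapT => ntj; apply: nj.
  exists j; first by rewrite mem_index_enum.
  rewrite /= indicE memNset //=; by rewrite in_itv.
rewrite integral_indic ?setIT // in cI; last exact: measurable_unit_cube.
rewrite probability_setC; last exact: measurable_unit_cube.
by rewrite cI subee.
Qed.
End cube.

Section tensor.
Context {R : realType} {disp : measure_display} {Om : measurableType disp}.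
Variables (d N : nat) (g r : nat -> R).
Hypothesis hr : forall j, (0 < j)%N -> 2^-1 < r j.

(** Frequencies are cut at N in each coordinate, which makes the index set
    finite. *)
Definition mode := {ffun 'I_d -> option ('I_N * bool)}.

(** Forgets the cut-off N, so that the basis functions are indexed
    independently of it. *)
Definition mode_label (o : option ('I_N * bool)) : option (nat * bool) :=
  omap (fun p => (nat_of_ord p.1, p.2)) o.

Lemma mode_label_inj : injective mode_label.
Proof. by move=> [[k b]|] [[l c]|] //= -[] /val_inj -> ->. Qed.

Definition tensor_trig (i : mode) (t : d.-tuple R) : R :=
  \prod_(j < d) trig (mode_label (i j)) (tnth t j).

Definition tensor_eigenvalue (i : mode) : R :=
  \prod_(j < d) korobov_eigenvalue (g j.+1) (r j.+1) (mode_label (i j)).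

(** The common value of the kernel on the diagonal, that is the product
    of the univariate traces. *)
Definition tensor_trace : R :=
  \prod_(j < d) korobov_kernel (g j.+1) (r j.+1) 0 0.

Lemma bounded_measurable_tensor_trig i :
  bounded_measurable (tensor_trig i : d.-tuple (measurableTypeR R) -> R).
Proof.
exact: (bounded_measurable_tprod
  (fun j => bounded_measurable_trig (mode_label (i j)))).
Qed.

Lemma tensor_trig_le i t : `|tensor_trig i t| <= 2 ^+ d.
Proof.
rewrite normr_prod -[leRHS]mulr1 -[in leRHS](card_ord d) -prodr_const mulr1.
by apply: ler_prod => j _; rewrite normr_ge0 trig_norm_le.
Qed.

Lemma tensor_trig_orthonormal i i' :
  \int[cube_measure d]_t (tensor_trig i t * tensor_trig i' t) = (i == i')%:R.
Proof.
under eq_Rintegral do rewrite -big_split /=.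
rewrite (@integral_cube_prod _ d
  (fun j s => trig (mode_label (i j)) s * trig (mode_label (i' j)) s)); last first.
  by move=> j; apply: bounded_measurableM; exact: bounded_measurable_trig.
under eq_bigr do rewrite trig_orthonormal (inj_eq mode_label_inj).
have [->|/eqP ii'] := eqVneq i i'; first by rewrite big1 // => j _; rewrite eqxx.
apply/eqP; rewrite prodf_seq_eq0; apply/hasP; apply: contrapT => nj.
apply: ii'; apply/ffunP => j; apply/eqP; apply: contrapT => /negP/negbTE ij.
by apply: nj; exists j; [exact: mem_index_enum | rewrite /= ij].
Qed.

Lemma bounded_measurable_tensor_kernel (t : d.-tuple R) : bounded_measurable
  (tensor_korobov_kernel g r t : d.-tuple (measurableTypeR R) -> R).
Proof.
apply: (@bounded_measurable_tprod _ _
  (fun j => korobov_kernel (g j.+1) (r j.+1) (tnth t j))) => j.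
by apply: bounded_measurable_korobov_kernel; exact: hr.
Qed.

Lemma tensor_kernel_eigen (t : d.-tuple R) i :
  \int[cube_measure d]_s (tensor_korobov_kernel g r t s * tensor_trig i s) =
  tensor_eigenvalue i * tensor_trig i t.
Proof.
under eq_Rintegral do rewrite -big_split /=.
rewrite (@integral_cube_prod _ d (fun j s =>
  korobov_kernel (g j.+1) (r j.+1) (tnth t j) s * trig (mode_label (i j)) s)).
  rewrite -big_split /=; apply: eq_bigr => j _.
  by rewrite integral_korobov_kernel // hr.
move=> j; apply: bounded_measurableM; last exact: bounded_measurable_trig.
by apply: bounded_measurable_korobov_kernel; exact: hr.
Qed.

Lemma tensor_kernel_diag (t : d.-tuple R) :
  tensor_korobov_kernel g r t t = tensor_trace.
Proof.
by apply: eq_bigr => j _; rewrite /korobov_kernel !subrr.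
Qed.

Variables (P : probability Om R) (B : Om -> L2 (@cube_measure R d)).
Hypothesis hB : zero_mean_field P (@unit_cube R d)
  (@tensor_korobov_kernel R g r d) B.

Let mD := @measurable_unit_cube R d.
Let D0 := @cube_measure_unit_cube R d.
Let Kdiag (t : d.-tuple R) (_ : unit_cube t) := tensor_kernel_diag t.
Let mK (t : d.-tuple R) : measurable_fun setT (tensor_korobov_kernel g r t).
Proof. by case: (bounded_measurable_tensor_kernel t). Qed.

Lemma tensor_avg_error0 : avg_error P B 0 = (Num.sqrt tensor_trace)%:E.
Proof. exact: (avg_error0 hB mD D0 Kdiag). Qed.

Lemma tensor_eigenfamily n (f : 'I_n -> mode) : injective f ->
  exists phi : 'I_n -> L2 (@cube_measure R d),
  [/\ forall k t, `|phi k t| <= 2 ^+ d,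
    forall k l, ip (cube_measure d) (phi k) (phi l) = (k == l)%:R &
    forall k t, unit_cube t -> (\int[cube_measure d]_s
        (tensor_korobov_kernel g r t s * phi k s)%:E =
      (tensor_eigenvalue (f k) * phi k t)%:E)%E].
Proof.
move=> f_inj.
have /choice[phi phiE] k := bounded_measurable_L2 (@cube_measure R d)
  (bounded_measurable_tensor_trig (f k)).
exists phi; split=> [k t|k l|k t _].
- by rewrite phiE tensor_trig_le.
- rewrite -(inj_eq f_inj) -tensor_trig_orthonormal; apply: eq_Rintegral => t _.
  by rewrite !phiE.
- under eq_integral do rewrite phiE.
  rewrite bounded_measurable_EFin ?tensor_kernel_eigen ?phiE //.
  apply: bounded_measurableM; first exact: bounded_measurable_tensor_kernel.
  exact: bounded_measurable_tensor_trig.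
Qed.

Lemma tensor_avg_error_le (S : {set mode}) :
  (avg_error P B #|S| <=
    (Num.sqrt (tensor_trace - \sum_(i in S) tensor_eigenvalue i))%:E)%E.
Proof.
have [phi [phi_le phi_orth phi_eigen]] :=
  tensor_eigenfamily (@enum_val_inj _ (mem S)).
rewrite big_enum_val /=.
exact: (avg_error_le hB mD D0 Kdiag mK phi_le phi_orth phi_eigen).
Qed.

Lemma tensor_avg_error_lt n (b : R) : 0 <= b ->
  (avg_error P B n < (Num.sqrt b)%:E)%E ->
  exists p : mode -> R, [/\ forall i, 0 <= p i <= 1,
    \sum_i p i <= n%:R & \sum_i tensor_eigenvalue i * (1 - p i) <= b].
Proof.
move=> b0 err.
have [phi [phi_le phi_orth phi_eigen]] :=
  tensor_eigenfamily (@enum_val_inj _ (mem mode)).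
have [p [p01 pn plam]] :=
  avg_error_lt hB mD D0 Kdiag mK phi_le phi_orth phi_eigen b0 err.
have rankbij : {on [pred _ | true], bijective (@enum_rank mode)}.
  by apply: onW_bij; exact: enum_rank_bij.
exists (fun i => p (enum_rank i)); split=> [i||]; first exact: p01.
- by rewrite (reindex _ rankbij) in pn.
- rewrite (reindex _ rankbij) /= in plam.
  by under eq_bigr do rewrite -[X in tensor_eigenvalue X]enum_rankK.
Qed.

End tensor.

(** * Scalar inequalities *)

Section scalar_bounds.
Context {R : realType}.
Implicit Types x y a b g r q eta : R.

(** Additive excess over a number b >= 1 costs at most its exponential as a
    factor. *)
Lemma le_mul_expRB a b : 1 <= b -> b <= a -> a <= b * expR (a - b).
Proof.
move=> b1 ba; have := expR_ge1Dx (a - b); nra.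
Qed.

Lemma le_expR_mul y : 0 <= y -> expR y - 1 <= y * expR y.
Proof.
move=> y0; have := expR_ge1Dx (- y); rewrite expRN.
have := expR_gt0 y; move: (expR y) => z z0 zy.
have : (1 - y) * z <= z^-1 * z by rewrite ler_wpM2r // ltW.
by rewrite mulVf ?gt_eqF //; nra.
Qed.

Lemma powR_expR g x : 0 < g -> g `^ x = expR (x * ln g).
Proof. by move=> g0; rewrite /powR gt_eqF. Qed.

Lemma expR_norm_ln g : 0 < g <= 1 -> g = expR (- `|ln g|).
Proof.
move=> /andP[g0 g1]; rewrite ler0_norm ?opprK ?ln_le0 //.
by rewrite lnK // posrE.
Qed.

(** With y = |ln g| the left-hand side is g (exp (q y) - 1). When y <= 2 L the
    product q y is at most 1 and the first term suffices; otherwise g is so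
    small that g^(1-q) <= exp (- L) <= 1/d. *)
Lemma powR1B_sub_le g q eta L (d : nat) :
  0 < g <= 1 -> 0 < eta <= 2^-1 -> q * L = eta -> 1 <= L -> ln d%:R <= L ->
  (0 < d)%N ->
  g `^ (1 - q) - g <= expR 1 * q * (g * `|ln g|) + d%:R^-1.
Proof.
move=> g01 /andP[eta0 eta2] qL L1 dL d0; set y := `|ln g|.
have g0 : 0 < g by case/andP: g01.
have q0 : 0 < q by nra.
have q2 : q <= 2^-1 by nra.
have y0 : 0 <= y by exact: normr_ge0.
have lng : ln g = - y by rewrite /y ler0_norm ?opprK ?ln_le0 //; case/andP: g01.
have gE : g = expR (- y) by exact: expR_norm_ln.
have d_inv : 0 <= (d%:R : R)^-1 by rewrite invr_ge0.
have [yL|Ly] := leP y (2 * L).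
  have qy : q * y <= 1 by nra.
  have -> : g `^ (1 - q) = g * expR (q * y).
    by rewrite powR_expR // lng [in RHS]gE -expRD; congr expR; ring.
  have qy0 : 0 <= q * y by nra.
  have e1 := le_expR_mul qy0.
  have e2 : expR (q * y) <= expR 1 by rewrite ler_expR.
  have e3 : 0 <= g * (q * y) by rewrite mulr_ge0 // ltW.
  have e4 : g * (expR (q * y) - 1) <= g * (q * y * expR (q * y)).
    by rewrite ler_wpM2l // ltW.
  have e5 : g * (q * y) * expR (q * y) <= g * (q * y) * expR 1.
    by rewrite ler_wpM2l.
  nra.
have : g `^ (1 - q) <= d%:R^-1.
  rewrite powR_expR // lng.
  apply: (@le_trans _ _ (expR (- L))); first by rewrite ler_expR; nra.
  rewrite expRN lef_pV2 ?posrE ?expR_gt0 ?ltr0n //.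
  by rewrite -[leLHS]lnK ?posrE ?ltr0n // ler_expR.
have : 0 <= expR 1 * q * (g * y).
  by rewrite !mulr_ge0 ?expR_ge0 // ltW.
lra.
Qed.

(** With y = |ln g| and x = y / v, the bound 1 - exp (- x) >= x / 2 settles the
    case x <= 1; otherwise y exp (- y / 2) <= 2 and exp (- y / 2) <= 1/d. *)
Lemma mul_norm_ln_le g v (d : nat) : 0 < g <= 1 -> 0 < v -> 2 * ln d%:R <= v ->
  (0 < d)%N ->
  g * `|ln g| <= 2 * v * (g * (1 - g `^ v^-1)) + 2 * d%:R^-1.
Proof.
move=> g01 v0 dv d0; set y := `|ln g|.
have g0 : 0 < g by case/andP: g01.
have y0 : 0 <= y by exact: normr_ge0.
have lng : ln g = - y by rewrite /y ler0_norm ?opprK ?ln_le0 //; case/andP: g01.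
have gE : g = expR (- y) by exact: expR_norm_ln.
have d_inv : 0 <= (d%:R : R)^-1 by rewrite invr_ge0.
have -> : g `^ v^-1 = expR (- (y / v)).
  by rewrite powR_expR // lng; congr expR; ring.
set x := y / v; have yE : y = v * x by rewrite /x; field; rewrite gt_eqF.
have x0 : 0 <= x by rewrite divr_ge0 // ltW.
have ex1 : expR (- x) <= 1 by rewrite expR_le1 oppr_le0.
have [yv|vy] := leP y v.
  have x1 : x <= 1 by rewrite ler_pdivrMr // mul1r.
  have xe : x <= 2 * (1 - expR (- x)).
    have := expR_ge1Dx x; have := expRxMexpNx_1 x; have := expR_gt0 (- x).
    move: (expR x) (expR (- x)) => a b b0 ab xa.
    have : (1 + x) * b <= 1 by rewrite -[leRHS]ab ler_wpM2r // ltW.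
    nra.
  rewrite yE; have : g * v * x <= g * v * (2 * (1 - expR (- x))).
    by rewrite ler_wpM2l // mulr_ge0 // ltW.
  nra.
have h1 : g * y <= 2 * d%:R^-1.
  have -> : g = expR (- (y / 2)) * expR (- (y / 2)).
    by rewrite -expRD {1}gE; congr expR; field.
  have e1 : expR (- (y / 2)) * y <= 2.
    have := expR_ge1Dx (y / 2); have := expRxMexpNx_1 (y / 2).
    have := expR_gt0 (- (y / 2)).
    move: (expR (y / 2)) (expR (- (y / 2))) => a b b0 ab xa.
    have : (1 + y / 2) * b <= 1 by rewrite -[leRHS]ab ler_wpM2r // ltW.
    nra.
  have e2 : expR (- (y / 2)) <= d%:R^-1.
    rewrite expRN lef_pV2 ?posrE ?expR_gt0 ?ltr0n //.
    rewrite -[leLHS]lnK ?posrE ?ltr0n // ler_expR; lra.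
  by rewrite mulrAC ler_pM ?mulr_ge0 ?expR_ge0.
have : 0 <= 2 * v * (g * (1 - expR (- x))).
  by rewrite !mulr_ge0 ?subr_ge0 // ltW.
lra.
Qed.

(** Convexity of the exponential between 0 and eta ln x, proved from
    1 + u <= exp u at two points. *)
Lemma powR_sub1_le x q eta : 1 <= x -> 0 <= q <= eta -> 0 < eta ->
  x `^ q - 1 <= q / eta * x `^ eta.
Proof.
move=> x1 /andP[q0 qe] eta0; have x0 : 0 < x by exact: lt_le_trans x1.
set t := q / eta.
have t0 : 0 <= t by rewrite divr_ge0 // ltW.
have t1 : t <= 1 by rewrite ler_pdivrMr // mul1r.
rewrite !powR_expR //; set w := eta * ln x.
have -> : q * ln x = t * w by rewrite /t /w; field; rewrite gt_eqF.
have h1 : expR (t * w) * (1 + (1 - t) * w) <= expR w.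
  have -> : expR w = expR (t * w) * expR ((1 - t) * w).
    by rewrite -expRD; congr expR; ring.
  by rewrite ler_wpM2l ?expR_ge0 // expR_ge1Dx.
have h2 : expR (t * w) * (1 - t * w) <= 1.
  rewrite -[leRHS](expRxMexpNx_1 (t * w)) ler_wpM2l ?expR_ge0 //.
  exact: expR_ge1Dx.
have := ler_wpM2l t0 h1.
have t1' : 0 <= 1 - t by rewrite subr_ge0.
have := ler_wpM2l t1' h2.
move: (expR (t * w)) (expR w) => a b; nra.
Qed.

End scalar_bounds.

(** * Power sums of the univariate eigenvalues *)

Section marginal_sums.
Context {R : realType}.
Implicit Types x g r q eta Z : R.

(** The power sum with exponent x of the eigenvalues with frequency at most
    N; the factor 2 accounts for cosine and sine, the 1 for the constant
    function. *)
Definition marginal_sum (g r : R) (N : nat) (x : R) : R :=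
  1 + 2 * \sum_(k < N) (g * k.+1%:R `^ (- (2 * r))) `^ x.

Lemma powRN_natS_01 r k : 0 < r -> 0 < (k.+1%:R : R) `^ (- r) <= 1.
Proof.
move=> r0; rewrite powR_gt0 ?ltr0n //= powRN invf_le1 ?powR_gt0 ?ltr0n //.
by rewrite -[leLHS](powRr0 k.+1%:R) ler_powR ?ler1n // ltW.
Qed.

Lemma marginal_eigenvalue_01 g r k : 0 < g <= 1 -> 0 < r ->
  0 < g * k.+1%:R `^ (- (2 * r)) <= 1.
Proof.
move=> /andP[g0 g1] r0; have r2 : 0 < 2 * r by rewrite mulr_gt0.
have /andP[k0 k1] := powRN_natS_01 k r2.
by rewrite mulr_gt0 //= mulr_ile1 // ltW.
Qed.

Lemma marginal_sum_ge1 g r N x : 1 <= marginal_sum g r N x.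
Proof.
by rewrite lerDl mulr_ge0 // sumr_ge0 // => k _; exact: powR_ge0.
Qed.

Lemma powR_1B x r : 0 < x -> x `^ (1 - r) = x * x `^ (- r).
Proof.
by move=> x0; rewrite powRD ?(gt_eqF x0) ?implybT // powRr1 // ltW.
Qed.

(** Each mu = g x with x = k^(-2r) satisfies mu^(1-q) - mu
    = (g^(1-q) - g) x^(1-q) + g (x^(1-q) - x). Here x^(1-q) is at most the
    corresponding term of the sum bounded by Z, and x^(1-q) - x is at most
    q / eta times it. The remaining factor, the q-th power of the trace, is at
    most exp (2 q g Z). *)
Lemma marginal_sum_powR1B_le g r r0 N q eta Z : 0 < g <= 1 -> 0 < r0 <= r ->
  0 < q <= eta -> eta <= 2^-1 ->
  \sum_(k < N) k.+1%:R `^ (- (2 * r0 * (1 - eta))) <= Z ->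
  marginal_sum g r N (1 - q) <= marginal_sum g r N 1 `^ (1 - q) *
    expR (2 * Z * (g `^ (1 - q) - g) + 2 * Z * g * (q / eta) + 2 * q * g * Z).
Proof.
move=> g01 /andP[r00 rr0] /andP[q0 qe] eta2 zZ.
have r_gt0 : 0 < r by exact: lt_le_trans rr0.
have eta0 : 0 < eta by exact: lt_le_trans qe.
have g0 : 0 < g by case/andP: g01.
have g1 : g <= 1 by case/andP: g01.
pose x k : R := k.+1%:R `^ (- (2 * r)).
pose z k : R := k.+1%:R `^ (- (2 * r0 * (1 - eta))).
have x01 k : 0 < x k <= 1 by apply: powRN_natS_01; rewrite mulr_gt0.
have x0 k : 0 < x k by case/andP: (x01 k).
have xz k : x k `^ (1 - eta) <= z k.
  rewrite /x /z -powRrM ler_powR ?ler1n //.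
  rewrite mulNr lerN2 ler_wpM2r // ?subr_ge0; lra.
have gq : g <= g `^ (1 - q).
  by rewrite -{1}[g]powRr1 ?(ltW g0) // ger_powR //; lra.
have xq k : x k <= x k `^ (1 - q) <= z k.
  rewrite -{1}[x k]powRr1 ?(ltW (x0 k)) // ger_powR //=; last by lra.
  by rewrite (le_trans _ (xz k)) // ger_powR //; lra.
have xqB k : x k `^ (1 - q) - x k <= q / eta * z k.
  apply: (@le_trans _ _ (q / eta * x k `^ (1 - eta))); last first.
    by rewrite ler_wpM2l // divr_ge0 // ltW.
  move: (x k) (x01 k) => y /andP[y0 y1].
  have yV1 : 1 <= y^-1 by rewrite invf_ge1.
  have := @powR_sub1_le R y^-1 q eta yV1.
  rewrite (ltW q0) qe -powR_inv1 ?(ltW y0) // -!powRrM !mulN1r => h.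
  have := ler_wpM2l (ltW y0) (h isT eta0).
  by rewrite mulrBr mulr1 -powR_1B // mulrCA -powR_1B.
have Z0 : 0 <= Z.
  by apply: le_trans zZ; apply: sumr_ge0 => k _; exact: powR_ge0.
have M1E y : (g * x y) `^ 1 = g * x y 
  by rewrite powRr1 // mulr_ge0 ?(ltW g0) ?(ltW (x0 _)).
have sum1 : \sum_(k < N) (g * x k) `^ 1 <= g * Z.
  under eq_bigr do rewrite M1E.
  rewrite -mulr_sumr ler_wpM2l ?(ltW g0) //.
  apply: le_trans zZ; apply: ler_sum => k _.
  by case/andP: (xq k) => /le_trans; apply.
have sumB : \sum_(k < N) (g * x k) `^ (1 - q) - \sum_(k < N) (g * x k) `^ 1 <=
    Z * (g `^ (1 - q) - g) + Z * g * (q / eta).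
  have -> : Z * (g `^ (1 - q) - g) + Z * g * (q / eta) =
      (g `^ (1 - q) - g + g * (q / eta)) * Z by ring.
  have c0 : 0 <= g `^ (1 - q) - g + g * (q / eta).
    by rewrite addr_ge0 ?subr_ge0 // mulr_ge0 ?divr_ge0 // ltW.
  apply: le_trans (ler_wpM2l c0 zZ); rewrite -sumrB mulr_sumr.
  apply: ler_sum => k _; rewrite M1E powRM ?(ltW g0) ?(ltW (x0 k)) //.
  have /andP[_ xq2] := xq k.
  have -> : g `^ (1 - q) * x k `^ (1 - q) - g * x k =
    (g `^ (1 - q) - g) * x k `^ (1 - q) + g * (x k `^ (1 - q) - x k) by ring.
  rewrite [leRHS]mulrDl lerD //; first by rewrite ler_wpM2l // subr_ge0.
  by rewrite -(mulrA g (q / eta)) ler_wpM2l ?(ltW g0) //; exact: xqB.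
have sum_le : marginal_sum g r N 1 <= marginal_sum g r N (1 - q).
  rewrite lerD2l ler_wpM2l // ler_sum // => k _.
  have [/andP[m0 m1]] := marginal_eigenvalue_01 k g01 r_gt0.
  by rewrite ger_powR ?m0 //; lra.
apply: (le_trans (le_mul_expRB (marginal_sum_ge1 g r N 1) sum_le)).
set M := marginal_sum g r N 1.
have M1 : 1 <= M by exact: marginal_sum_ge1.
have M0 : 0 < M by exact: lt_le_trans M1.
have {1}-> : M = M `^ (1 - q) * M `^ q.
  by rewrite -powRD ?(gt_eqF M0) ?implybT // subrK powRr1 // ltW.
rewrite -mulrA ler_wpM2l ?powR_ge0 //.
rewrite (powR_expR _ M0) -expRD ler_expR.
have lnM : ln M <= M - 1.
  by rewrite -{1}(subrK 1 M) addrC le_ln1Dx // ltrBrDl subrr.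
have qlnM : q * ln M <= q * (2 * (g * Z)).
  rewrite ler_wpM2l ?(ltW q0) // (le_trans lnM) //.
  by rewrite /M /marginal_sum addrC addKr ler_wpM2l.
have -> : marginal_sum g r N (1 - q) - M =
  2 * (\sum_(k < N) (g * x k) `^ (1 - q) - \sum_(k < N) (g * x k) `^ 1).
  by rewrite /M /marginal_sum; ring.
lra.
Qed.

(** Every mu (1 - mu^q) is nonnegative, so the gap is at least the
    contribution of the first frequency. *)
Lemma marginal_sum_powR1D_le g r N q Z : 0 < g <= 1 -> 0 < r ->
  0 < q -> (0 < N)%N -> marginal_sum g r N 1 <= 1 + 2 * Z ->
  marginal_sum g r N (1 + q) <= marginal_sum g r N 1 *
    expR (- (2 * (g * (1 - g `^ q)) / (1 + 2 * Z))).
Proof.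
move=> g01 r0 q0; case: N => // N _ MZ.
have g0 : 0 < g by case/andP: g01.
have g1 : g <= 1 by case/andP: g01.
set M := marginal_sum g r N.+1 1 in MZ *.
have M1 : 1 <= M by exact: marginal_sum_ge1.
have M0 : 0 < M by exact: lt_le_trans M1.
have gq1 : g `^ q <= 1 by rewrite -(powRr0 g) ger_powR // ltW.
have gap : M - marginal_sum g r N.+1 (1 + q) >= 2 * (g * (1 - g `^ q)).
  have -> : M - marginal_sum g r N.+1 (1 + q) =
    2 * (\sum_(k < N.+1) ((g * k.+1%:R `^ (- (2 * r))) `^ 1 -
                          (g * k.+1%:R `^ (- (2 * r))) `^ (1 + q))).
    by rewrite sumrB /M /marginal_sum; ring.
  rewrite ler_wpM2l // big_ord_recl /= powR1 mulr1 powRr1 ?(ltW g0) //.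
  have -> : g `^ (1 + q) = g * g `^ q.
    by rewrite powRD ?(gt_eqF g0) ?implybT // powRr1 // ltW.
  rewrite mulrBr mulr1 lerDl sumr_ge0 // => k _; rewrite subr_ge0.
  by rewrite ger_powR ?marginal_eigenvalue_01 // lerDl ltW.
apply: (@le_trans _ _ (M * (1 - 2 * (g * (1 - g `^ q)) / M))).
  by rewrite mulrBr mulr1 mulrCA divff ?gt_eqF // mulr1; lra.
rewrite ler_wpM2l ?(ltW M0) //.
apply: le_trans (expR_ge1Dx _); rewrite lerD2l lerN2.
rewrite ler_wpM2l ?mulr_ge0 ?subr_ge0 // ?(ltW g0) //.
by rewrite lef_pV2 ?posrE // (lt_le_trans M0).
Qed.

Lemma expR_le_marginal_sum g r N : 0 < g <= 1 -> (0 < N)%N ->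
  expR (2 / 3 * g) <= marginal_sum g r N 1.
Proof.
move=> /andP[g0 g1]; case: N => // N _.
apply: (@le_trans _ _ (1 + 2 * g)); last first.
  rewrite lerD2l ler_wpM2l // big_ord_recl /= powR1 mulr1 powRr1 ?(ltW g0) //.
  by rewrite lerDl sumr_ge0 // => k _; exact: powR_ge0.
have := expR_ge1Dx (- (2 / 3 * g)); have := expRxMexpNx_1 (2 / 3 * g).
have := expR_gt0 (2 / 3 * g); move: (expR _) (expR _) => a b a0 ab h.
have : (1 - 2 / 3 * g) * b <= 1.
  by rewrite -[leRHS]ab [leRHS]mulrC ler_wpM2r // ltW.
nra.
Qed.

End marginal_sums.

(** * Counting eigenvalues *)

Section counting.
Context {R : realType} {I : finType}.
Variable lam : I -> R.
Hypothesis lam_gt0 : forall i, 0 < lam i.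

Let Lam := \sum_i lam i.

(** Take the eigenvalues above theta Lam with theta^q = delta / M. Their
    number is bounded by Chebyshev's inequality for the (1 - q)-th powers, and the
    others satisfy lam <= lam^(1-q) (theta Lam)^q. *)
Lemma large_eigenvalues_set (q M delta : R) :
  0 < Lam -> 0 < q < 1 -> 1 <= M -> 0 < delta <= 1 ->
  \sum_i lam i `^ (1 - q) <= Lam `^ (1 - q) * M ->
  exists S : {set I}, #|S|%:R <= M * (M / delta) `^ q^-1 /\
    \sum_(i | i \notin S) lam i <= delta * Lam.
Proof.
move=> Lam0 /andP[q0 q1] M1 /andP[delta0 delta1] sumq.
have M0 : 0 < M by exact: lt_le_trans M1.
pose theta := (delta / M) `^ q^-1.
have dM0 : 0 < delta / M by rewrite divr_gt0.
have theta0 : 0 < theta by rewrite powR_gt0.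
have theta1 : theta <= 1.
  rewrite -[leRHS](powRr0 (delta / M)) ger_powR ?invr_ge0 ?(ltW q0) //.
  by rewrite dM0 ler_pdivrMr // mul1r (le_trans delta1).
have thetaq : theta `^ q = delta / M.
  by rewrite -powRrM mulVf ?gt_eqF // powRr1 // ltW.
have tL0 : 0 < theta * Lam by rewrite mulr_gt0.
have q1' : 0 <= 1 - q by rewrite subr_ge0 ltW.
have pow_split i : lam i = lam i `^ (1 - q) * lam i `^ q.
  rewrite -powRD ?(gt_eqF (lam_gt0 i)) ?implybT //.
  by rewrite subrK powRr1 // ltW.
exists [set i | theta * Lam < lam i]%SET; split.
  set S := [set i | _]%SET.
  have : #|S|%:R * (theta * Lam) `^ (1 - q) <= Lam `^ (1 - q) * M.
    apply: le_trans sumq; rewrite mulr_natl -sumr_const.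
    rewrite [leRHS](bigID (mem S)) /= -[leLHS]addr0 lerD //; last first.
      by apply: sumr_ge0 => i _; exact: powR_ge0.
    apply: ler_sum => i; rewrite inE => /ltW tl.
    by rewrite ge0_ler_powR // nnegrE ltW.
  rewrite powRM ?(ltW theta0) ?(ltW Lam0) // mulrA mulrC ler_pM2l ?powR_gt0 //.
  rewrite -ler_pdivlMr ?powR_gt0 // => /le_trans; apply.
  rewrite ler_wpM2l ?(ltW M0) // -powRN.
  have -> : (M / delta) `^ q^-1 = theta `^ (- 1).
    rewrite /theta -powRrM [q^-1 * _]mulrC powRrM powR_inv1 ?(ltW dM0) //.
    by rewrite invf_div.
  rewrite ger_powR ?theta0 // lerN2; lra.
under eq_bigl do rewrite inE -leNgt.
apply: (@le_trans _ _ (\sum_i lam i `^ (1 - q) * (theta * Lam) `^ q)).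
  rewrite [leRHS](bigID (fun i => lam i <= theta * Lam)) /=.
  rewrite -[leLHS]addr0 lerD ?sumr_ge0 // => [|i _]; last first.
    by rewrite mulr_ge0 ?powR_ge0.
  apply: ler_sum => i li; rewrite [leLHS]pow_split ler_wpM2l ?powR_ge0 //.
  by rewrite ge0_ler_powR ?(ltW q0) // nnegrE ltW.
rewrite -mulr_suml powRM ?(ltW theta0) ?(ltW Lam0) // thetaq.
apply: le_trans (ler_wpM2r _ sumq) _.
  by rewrite mulr_ge0 ?powR_ge0 // ltW.
have -> : Lam `^ (1 - q) * M * (delta / M * Lam `^ q) =
    delta * (Lam `^ (1 - q) * Lam `^ q) by field; rewrite gt_eqF.
rewrite -powRD ?(gt_eqF Lam0) ?implybT //.
by rewrite subrK powRr1 // ltW.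
Qed.

(** The p i are what an approximation of rank n provides at relative squared
    error 1/3. Eigenvalues below 1/(10 n) can capture at most 1/10 altogether,
    so the larger ones carry half of the sum, and each of those has
    lam^q >= (10 n)^-q. *)
Lemma rank_weights_bounds (p : I -> R) (n : nat) (Lfull : R) :
  (forall i, lam i <= 1) -> (forall i, 0 <= p i <= 1) ->
  \sum_i p i <= n%:R -> \sum_i lam i * (1 - p i) <= Lfull / 3 ->
  Lfull <= 6 / 5 * Lam -> 1 <= Lam -> (0 < n)%N ->
  Lam <= 10 * n%:R /\ forall q, 0 < q ->
    Lam / 2 * (10 * n%:R) `^ (- q) <= \sum_i lam i `^ (1 + q).
Proof.
move=> lam1 p01 pn err LL Lam1 n0.
have n0' : 0 < n%:R :> R by rewrite ltr0n.
have captured : 3 / 5 * Lam <= \sum_i lam i * p i.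
  have : \sum_i lam i * (1 - p i) = Lam - \sum_i lam i * p i.
    by rewrite -sumrB; apply: eq_bigr => i _; rewrite mulrBr mulr1.
  lra.
have capn : \sum_i lam i * p i <= n%:R.
  apply: le_trans pn; apply: ler_sum => i _.
  by have /andP[pi0 _] := p01 i; rewrite ler_piMl.
split=> [|q q0]; first by lra.
pose theta : R := (10 * n%:R)^-1.
have theta0 : 0 < theta by rewrite invr_gt0 mulr_gt0.
have -> : (10 * n%:R) `^ (- q) = theta `^ q.
  by rewrite /theta -powR_inv1 ?mulr_ge0 // -powRrM mulN1r.
apply: (@le_trans _ _ (\sum_i theta `^ q * (lam i * p i - theta * p i))).
  rewrite -mulr_sumr mulrC ler_wpM2l ?powR_ge0 // sumrB -mulr_sumr.
  have : theta * \sum_i p i <= theta * n%:R by rewrite ler_wpM2l // ltW.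
  have -> : theta * n%:R = 10^-1.
    by rewrite /theta; field; rewrite gt_eqF.
  lra.
apply: ler_sum => i _; have /andP[pi0 pi1] := p01 i.
have [tl|lt] := leP theta (lam i); last first.
  rewrite (le_trans _ (powR_ge0 _ _)) //.
  by rewrite mulr_ge0_le0 ?powR_ge0 // -mulrBl mulr_le0_ge0 // subr_le0 ltW.
have -> : lam i `^ (1 + q) = lam i `^ q * lam i.
  rewrite powRD ?(gt_eqF (lam_gt0 i)) ?implybT //.
  by rewrite powRr1 ?(ltW (lam_gt0 i)) // mulrC.
apply: (@le_trans _ _ (theta `^ q * lam i)).
  rewrite ler_wpM2l ?powR_ge0 // lerBlDr (@le_trans _ _ (lam i)) //.
    by rewrite ler_piMr // ltW.
  by rewrite lerDl mulr_ge0 // ltW.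
rewrite ler_wpM2r ?(ltW (lam_gt0 i)) //.
by rewrite ge0_ler_powR ?(ltW q0) // nnegrE ?(ltW theta0) // ltW.
Qed.

End counting.

Section box_sums.
Context {R : realType}.
Implicit Types (g r : nat -> R) (x : R).

Lemma prod_powR (J : Type) (s : seq J) (F : J -> R) x : (forall j, 0 <= F j) ->
  (\prod_(j <- s) F j) `^ x = \prod_(j <- s) F j `^ x.
Proof.
move=> F0; elim: s => [|j s IH]; first by rewrite !big_nil powR1.
by rewrite !big_cons powRM ?IH // prodr_ge0.
Qed.

Lemma korobov_eigenvalue_01 (g r : R) o : 0 < g <= 1 -> 0 < r ->
  0 < korobov_eigenvalue g r o <= 1.
Proof.
move=> g01 r0; case: o => [[k b]|] /=; last by rewrite ltr01 lexx.
exact: marginal_eigenvalue_01.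
Qed.

Lemma marginal_sumE (g r : R) N x :
  \sum_(o : option ('I_N * bool)) korobov_eigenvalue g r (mode_label o) `^ x =
  marginal_sum g r N x.
Proof.
rewrite (bigD1 None) //= powR1; congr (_ + _).
rewrite (reindex_omap Some id) /=; last by case.
under eq_bigl do rewrite eqxx.
rewrite (eq_bigr (fun p : 'I_N * bool => (g * p.1.+1%:R `^ (- (2 * r))) `^ x));
  last by case.
rewrite -(pair_bigA _ (fun (k : 'I_N) (_ : bool) =>
  (g * k.+1%:R `^ (- (2 * r))) `^ x)) /= mulr_sumr.
by apply: eq_bigr => k _; rewrite big_bool /= -mulr2n [RHS]mulr_natl.
Qed.

Lemma sum_tensor_eigenvalue d N g r x :
  (forall j, (0 < j)%N -> 0 < g j <= 1) -> (forall j, (0 < j)%N -> 0 < r j) ->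
  \sum_(i : mode d N) tensor_eigenvalue g r i `^ x =
  \prod_(j < d) marginal_sum (g j.+1) (r j.+1) N x.
Proof.
move=> g01 r0; under [RHS]eq_bigr do rewrite -marginal_sumE.
rewrite bigA_distr_bigA /=; apply: eq_bigr => i _; rewrite prod_powR // => j.
by apply/ltW; case/andP: (korobov_eigenvalue_01 (mode_label (i j)) (g01 j.+1 isT)
  (r0 j.+1 isT)).
Qed.

(** The largest eigenvalue is 1 because every g j is at most 1. *)
Lemma tensor_eigenvalue_01 d N g r (i : mode d N) :
  (forall j, (0 < j)%N -> 0 < g j <= 1) -> (forall j, (0 < j)%N -> 0 < r j) ->
  0 < tensor_eigenvalue g r i <= 1.
Proof.
move=> g01 r0; have e01 j := korobov_eigenvalue_01 (mode_label (i j))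
  (g01 j.+1 isT) (r0 j.+1 isT).
rewrite prodr_gt0 => [|j _]; last by case/andP: (e01 j).
by apply: prodr_ile1 => j _; case/andP: (e01 j) => /ltW -> ->.
Qed.

Lemma korobov_partial_diag (g r : R) N : 0 < g ->
  korobov_partial g r N 0 0 = marginal_sum g r N 1.
Proof.
move=> g0; rewrite /korobov_partial /marginal_sum -mulrA mulr_sumr.
congr (_ + _ * _); apply: eq_bigr => k _.
by rewrite subrr mulr0 cos0 mulr1 powRr1 // mulr_ge0 ?powR_ge0 // ltW.
Qed.

Lemma tensor_trace_cvg d g r :
  (forall j, (0 < j)%N -> 0 < g j <= 1) -> (forall j, (0 < j)%N -> 2^-1 < r j) ->
  \prod_(j < d) marginal_sum (g j.+1) (r j.+1) N 1 @[N --> \oo] -->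
  tensor_trace d g r.
Proof.
move=> g01 r2; rewrite /tensor_trace.
elim: (index_enum _) => [|j s IH].
  rewrite big_nil; under eq_fun do rewrite big_nil; exact: cvg_cst.
rewrite big_cons; under eq_fun do rewrite big_cons.
apply: cvgM; last exact: IH.
have /andP[gj0 _] := g01 j.+1 isT.
under eq_fun => N do rewrite -korobov_partial_diag //.
by apply: korobov_partial_cvg; exact: r2.
Qed.

Lemma prod_marginal_sum_ge1 d g r N x :
  1 <= \prod_(j < d) marginal_sum (g j.+1) (r j.+1) N x.
Proof.
apply: (@le_trans _ _ (\prod_(j < d) 1)); first by rewrite big1.
by apply: ler_prod => j _; rewrite ler01 marginal_sum_ge1.
Qed.

Lemma tensor_trace_ge1 d g r :
  (forall j, (0 < j)%N -> 0 < g j <= 1) -> (forall j, (0 < j)%N -> 2^-1 < r j) ->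
  1 <= tensor_trace d g r.
Proof.
move=> g01 r2; have cv := tensor_trace_cvg (d := d) g01 r2.
rewrite -(cvg_lim _ cv) //; apply: limr_ge; last first.
  by apply: nearW => N; exact: prod_marginal_sum_ge1.
by apply/cvg_ex; exists (tensor_trace d g r).
Qed.

Lemma tensor_trace_approx d g r (delta : R) :
  (forall j, (0 < j)%N -> 0 < g j <= 1) -> (forall j, (0 < j)%N -> 2^-1 < r j) ->
  0 < delta -> exists N, (0 < N)%N /\
    `|tensor_trace d g r - \prod_(j < d) marginal_sum (g j.+1) (r j.+1) N 1| <
      delta.
Proof.
move=> g01 r2 delta0; have /cvgrPdist_lt/(_ delta delta0) :=
  tensor_trace_cvg (d := d) g01 r2.
move=> [N _ close]; exists N.+1; split=> //; exact: (close N.+1 (leqnSn N)).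
Qed.

End box_sums.

(** * Quasi-polynomial tractability *)

Section tractability.
Context {R : realType}.
Variables (r g : nat -> R) (r0 : R).
Hypotheses (r0_gt : 2^-1 < r0) (r_ge : forall j, (0 < j)%N -> r0 <= r j)
  (g01 : forall j, (0 < j)%N -> 0 < g j <= 1).
Context {disp : nat -> measure_display}
  {Om : forall d : nat, measurableType (disp d)}.
Variables (P : forall d : nat, probability (Om d) R)
  (B : forall d : nat, Om d -> L2 (@cube_measure R d)).
Hypothesis hB : forall d : nat, (0 < d)%N ->
  zero_mean_field (P d) (@unit_cube R d) (@tensor_korobov_kernel R g r d) (@B d).

Let r2 j : (0 < j)%N -> 2^-1 < r j.
Proof. by move=> j0; exact: lt_le_trans (r_ge j0). Qed.

Let r_gt0 j : (0 < j)%N -> 0 < r j.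
Proof. by move=> /r2; apply: lt_trans. Qed.

Let r00 : 0 < r0. Proof. by apply: lt_trans r0_gt. Qed.

Lemma ln_plus_bounds (d : nat) : (0 < d)%N ->
  [/\ 1 <= ln_plus (d%:R : R), ln (d%:R : R) <= ln_plus d%:R &
      ln_plus (d%:R : R) <= 1 + ln d%:R].
Proof.
move=> d0; have lnd : 0 <= ln (d%:R : R) by rewrite ln_ge0 // ler1n.
by rewrite /ln_plus !le_max ge_max lexx lexx orbT lerDl lnd lerDr ler01.
Qed.

Lemma sum_inv_nat (d : nat) : (0 < d)%N -> \sum_(j < d) (d%:R : R)^-1 = 1.
Proof.
move=> d0; rewrite sumr_const card_ord -[_ *+ d]mulr_natl mulfV //.
by rewrite pnatr_eq0 -lt0n.
Qed.

Let weight_sum d := \sum_(1 <= j < d.+1) (1 + `|ln (g j)|) * g j.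

Lemma weight_sumE d : weight_sum d =
  \sum_(j < d) g j.+1 + \sum_(j < d) g j.+1 * `|ln (g j.+1)|.
Proof.
rewrite /weight_sum big_add1 /= big_mkord -big_split /=.
by apply: eq_bigr => j _; rewrite mulrDl mul1r mulrC.
Qed.

Section sufficiency.
Variable A : R.
Hypotheses (A0 : 0 <= A)
  (weight_le : forall d, (0 < d)%N -> weight_sum d <= A * ln_plus d%:R).

Let eta := (1 - (2 * r0)^-1) / 2.
Let Z := 1 + (2 * r0 * (1 - eta) - 1)^-1.

Let eta_half : 0 < eta <= 2^-1.
Proof.
have i0 : 0 < (2 * r0)^-1 by rewrite invr_gt0 mulr_gt0.
have i1 : (2 * r0)^-1 < 1 by rewrite invf_lt1 ?mulr_gt0 //; move: r0_gt; lra.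
by apply/andP; split; rewrite /eta; lra.
Qed.

Let exponent_gt1 : 1 < 2 * r0 * (1 - eta).
Proof.
have -> : 2 * r0 * (1 - eta) = r0 + 2^-1.
  by rewrite /eta; field; rewrite gt_eqF.
by move: r0_gt; lra.
Qed.

Let Z_ge1 : 1 <= Z.
Proof. by rewrite lerDl invr_ge0 subr_ge0 ltW. Qed.

Let Bc := 2 * Z * (expR 1 * A + 1 + 2 * A).

(** As q ln_+ d = eta, the hypothesis on the weights bounds q times their sum
    by a constant; the errors 1/d of [powR1B_sub_le] add up to 1. *)
Lemma power_sum_le d N (q : R) : (0 < d)%N -> q = eta / ln_plus d%:R ->
  \prod_(j < d) marginal_sum (g j.+1) (r j.+1) N (1 - q) <=
  (\prod_(j < d) marginal_sum (g j.+1) (r j.+1) N 1) `^ (1 - q) * expR Bc.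
Proof.
move=> d0 qE; have [L1 dL _] := ln_plus_bounds d0.
set L := ln_plus _ in L1 dL qE; have L0 : 0 < L by exact: lt_le_trans L1.
have /andP[eta0 eta2] := eta_half; have Z1 := Z_ge1; have A_ge0 := A0.
have qL : q * L = eta by rewrite qE; field; rewrite gt_eqF.
have q0 : 0 < q by rewrite qE divr_gt0.
have qeta : q <= eta by nra.
pose E j := 2 * Z * (g j.+1 `^ (1 - q) - g j.+1) + 2 * Z * g j.+1 * (q / eta) +
  2 * q * g j.+1 * Z.
have : \sum_(j < d) E j <= Bc.
  pose c := expR 1 * q.
  have le1 : \sum_(j < d) E j <= \sum_(j < d) (2 * Z *
      (c * (g j.+1 * `|ln (g j.+1)|) + d%:R^-1) +
      2 * Z * (q / eta + q) * g j.+1).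
    apply: ler_sum => j _; rewrite /E.
    have := powR1B_sub_le (g01 (isT : 0 < j.+1)%N) eta_half qL L1 dL d0.
    rewrite -/c; move: (g _ `^ _) (g _ * `|_|) (d%:R^-1) => u w i h.
    have : 2 * Z * (u - g j.+1) <= 2 * Z * (c * w + i).
      by rewrite ler_wpM2l //; lra.
    lra.
  apply: (le_trans le1).
  rewrite big_split /= -!mulr_sumr big_split /= -mulr_sumr sum_inv_nat //.
  have := weight_le d0; rewrite weight_sumE -/L.
  set sg := \sum_(j < d) g j.+1; set sl := \sum_(j < d) _ * _ => wle.
  have sg0 : 0 <= sg.
    by apply: sumr_ge0 => j _; have /andP[/ltW] := g01 (isT : 0 < j.+1)%N.
  have sl0 : 0 <= sl.
    apply: sumr_ge0 => j _; rewrite mulr_ge0 //.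
    by have /andP[/ltW] := g01 (isT : 0 < j.+1)%N.
  have qsum x : 0 <= x -> x <= A * L -> q * x <= A.
    move=> x0 xAL; apply: (@le_trans _ _ (q * (A * L))).
      by rewrite ler_wpM2l // ltW.
    by rewrite mulrCA qL ler_piMr //; lra.
  have e1 : c * sl <= expR 1 * A.
    by rewrite /c -mulrA ler_wpM2l ?expR_ge0 // qsum //; lra.
  have e2 : (q / eta + q) * sg <= 2 * A.
    have -> : (q / eta + q) * sg = q / eta * sg + q * sg by ring.
    have : q / eta * sg <= A.
      have -> : q / eta = L^-1 by rewrite qE; field; rewrite !gt_eqF.
      by rewrite mulrC ler_pdivrMr //; lra.
    have := qsum sg sg0; lra.
  rewrite /Bc -(mulrA (2 * Z) (q / eta + q)) -mulrDr ler_wpM2l //; lra.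
move=> EB.
apply: (@le_trans _ _ (\prod_(j < d)
    (marginal_sum (g j.+1) (r j.+1) N 1 `^ (1 - q) * expR (E j)))).
  apply: ler_prod => j _.
  rewrite (le_trans ler01 (marginal_sum_ge1 _ _ _ _)) /=.
  apply: (marginal_sum_powR1B_le (r0 := r0)) => //.
  - exact: g01.
  - by rewrite r00 r_ge.
  - by rewrite q0.
  - exact: (sum_powRN_le N exponent_gt1).
rewrite big_split /= -prod_powR; last first.
  by move=> j; exact: le_trans (marginal_sum_ge1 _ _ _ _).
by rewrite ler_wpM2l ?powR_ge0 // -expR_sum ler_expR.
Qed.

(** Half of the allowed error absorbs the eigenvalues outside the chosen set,
    the rest pays for the truncation of the frequencies. The constant mode is
    added to the set to make it nonempty. *)
Lemma tractable_of_weight_bound :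
  quasi_polynomially_tractable (fun d eps => avg_complexity (P d) (@B d) eps).
Proof.
have /andP[eta0 eta2] := eta_half; have Z1 := Z_ge1; have A_ge0 := A0.
have Bc0 : 0 <= Bc.
  have eA : 0 <= expR 1 * A by rewrite mulr_ge0 ?expR_ge0.
  by rewrite /Bc; apply: mulr_ge0; lra.
pose s := Bc + (Bc + 2) / eta.
have s0 : 0 <= s by rewrite addr_ge0 // divr_ge0 ?addr_ge0 // ltW.
exists 2, s; split=> // d eps d0 /andP[eps0 eps1].
have [L1 dL LD] := ln_plus_bounds d0; set L := ln_plus _ in L1 dL LD.
have L0 : 0 < L by exact: lt_le_trans L1.
pose q := eta / L.
have q0 : 0 < q by rewrite divr_gt0.
have q1 : q < 1 by rewrite ltr_pdivrMr //; lra.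
pose T := tensor_trace d g r.
have T1 : 1 <= T by exact: tensor_trace_ge1.
have e2 : 0 < eps ^+ 2 <= 1 by rewrite exprn_gt0 //= expr_le1 // ltW.
have /andP[e20 e21] := e2.
(* The cut-off N is chosen so that the neglected trace is below eps^2 / 4. *)
have e4 : 0 < eps ^+ 2 / 4 by rewrite divr_gt0.
have [N [_ TN]] := @tensor_trace_approx _ d g r _ g01 r2 e4.
set LN := \prod_(j < d) _ in TN; rewrite -/T in TN.
have /ltr_normlP[TN1 TN2] := TN.
have lam01 (i : mode d N) := tensor_eigenvalue_01 i g01 r_gt0.
have lam0 (i : mode d N) : 0 < tensor_eigenvalue g r i.
  by case/andP: (lam01 i).
have sumE x := sum_tensor_eigenvalue d N x g01 r_gt0.
have LNE : \sum_(i : mode d N) tensor_eigenvalue g r i = LN.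
  by rewrite /LN -sumE; apply: eq_bigr => i _; rewrite powRr1 // ltW.
have LN1 : 1 <= LN by exact: prod_marginal_sum_ge1.
pose M := expR Bc; pose delta := eps ^+ 2 / 2.
have M1 : 1 <= M by rewrite /M; have := expR_ge1Dx Bc; lra.
have M0 : 0 < M by exact: lt_le_trans M1.
have delta0 : 0 < delta by rewrite divr_gt0.
have sumq : \sum_(i : mode d N) tensor_eigenvalue g r i `^ (1 - q) <=
    (\sum_(i : mode d N) tensor_eigenvalue g r i) `^ (1 - q) * M.
  by rewrite sumE LNE; exact: power_sum_le.
have SLN : 0 < \sum_(i : mode d N) tensor_eigenvalue g r i.
  by rewrite LNE (lt_le_trans ltr01).
have q01 : 0 < q < 1 by rewrite q0.
have delta01 : 0 < delta <= 1 by rewrite delta0 /delta; lra.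
have [S [Scard Stail]] := large_eigenvalues_set lam0 SLN q01 M1 delta01 sumq.
(* The constant mode keeps the number of terms positive. *)
pose i0 : mode d N := [ffun=> None].
pose S' := (i0 |: S)%SET.
have S'pos : (0 < #|S'|)%N by apply/card_gt0P; exists i0; rewrite finset.setU11.
have S'card : #|S'|%:R <= #|S|%:R + 1 :> R.
  rewrite natr1 ler_nat /S' cardsU1; by case: (_ \notin _); rewrite ?leqnSn.
have S'tail : T - \sum_(i in S') tensor_eigenvalue g r i <= eps ^+ 2 * T.
  have : \sum_(i in S) tensor_eigenvalue g r i <=
      \sum_(i in S') tensor_eigenvalue g r i.
    rewrite [leRHS](bigID (mem S)) /= -[leLHS]addr0 lerD //; last first.
      by apply: sumr_ge0 => i _; rewrite ltW.
    rewrite le_eqVlt; apply/orP; left; apply/eqP; apply: eq_bigl => i.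
    by rewrite !inE; case: (i \in S); rewrite ?orbT ?andbF.
  have := LNE; rewrite (bigID (mem S)) /= => LNS.
  rewrite LNE in Stail.
  have dLN : delta * LN <= delta * (T + eps ^+ 2 / 4).
    by rewrite ler_wpM2l ?(ltW delta0) //; lra.
  have ee : eps ^+ 2 * eps ^+ 2 <= eps ^+ 2 by rewrite ler_piMr // ltW.
  have eT : eps ^+ 2 <= eps ^+ 2 * T by rewrite ler_peMr // ltW.
  by move=> SS'; rewrite /delta in Stail dLN; lra.
have complexity_le : (avg_complexity (P d) (@B d) eps <= (#|S'|%:R)%:E)%E.
  apply: ereal_inf_lbound; exists #|S'| => //; split=> //.
  rewrite (tensor_avg_error0 (hB d0)).
  apply: le_trans (tensor_avg_error_le r2 (hB d0) S') _.
  rewrite -EFinM lee_fin -{1}(ger0_norm (ltW eps0)) -sqrtr_sqr -sqrtrM ?sqr_ge0 //.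
  exact: ler_wsqrtr.
apply: (le_trans complexity_le); rewrite lee_fin.
pose l := ln eps^-1; pose D := 1 + ln (d%:R : R).
have l0 : 0 <= l by rewrite ln_ge0 // invf_ge1 // ltW.
have D1 : 1 <= D by exact: le_trans LD.
(* As 1/q = L / eta, the number of terms has the required exponential form. *)
have Y : M * (M / delta) `^ q^-1 = expR (Bc + L / eta * (Bc + ln 2 + 2 * l)).
  have -> : M / delta = expR (Bc + ln 2 + 2 * l).
    have -> : 2 * l = l + l by ring.
    have el : expR l = eps^-1 by rewrite lnK // posrE invr_gt0.
    rewrite !expRD el lnK ?posrE // -/M /delta; field; rewrite gt_eqF //.
  rewrite -expRM -expRD; congr expR; rewrite /q; field; rewrite !gt_eqF //.
set y := M * _ in Scard Y.
have ln20 : 0 <= ln 2 :> R by rewrite ln_ge0 // ler1n.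
have exponent_ge0 : 0 <= Bc + ln 2 + 2 * l by lra.
have y1 : 1 <= y.
  rewrite Y -[leLHS]expR0 ler_expR.
  by rewrite addr_ge0 // mulr_ge0 // divr_ge0 // ltW.
apply: (@le_trans _ _ (2 * y)); first by lra.
rewrite ler_wpM2l // Y ler_expR.
have ln2 : ln 2 <= 1 :> R.
  by rewrite (_ : 2 = 1 + 1) // le_ln1Dx // (lt_le_trans (ltrN10 _)).
rewrite -/l -/D /s.
have K0 : 0 <= (1 + l) * D - 1 by nra.
have t1 : Bc <= Bc * ((1 + l) * D) by nra.
have t2 : L / eta * (Bc + ln 2 + 2 * l) <= (Bc + 2) / eta * ((1 + l) * D).
  have -> : L / eta * (Bc + ln 2 + 2 * l) = (L * (Bc + ln 2 + 2 * l)) / eta by ring.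
  have -> : (Bc + 2) / eta * ((1 + l) * D) = (D * ((Bc + 2) * (1 + l))) / eta.
    by ring.
  rewrite ler_pM2r ?invr_gt0 //; apply: ler_pM => //.
  - exact: ltW.
  - nra.
nra.
Qed.

End sufficiency.
Section necessity.
Let Z := 1 + (2 * r0 - 1)^-1.

Let twice_r0_gt1 : 1 < 2 * r0. Proof. by move: r0_gt; lra. Qed.

Let Z_ge1 : 1 <= Z.
Proof. by rewrite lerDl invr_ge0 subr_ge0 ltW. Qed.

Lemma marginal_sum_le j N : (0 < j)%N ->
  marginal_sum (g j) (r j) N 1 <= 1 + 2 * Z.
Proof.
move=> j0; have /andP[gj0 gj1] := g01 j0; rewrite lerD2l ler_wpM2l //.
apply: le_trans (sum_powRN_le N twice_r0_gt1); apply: ler_sum => k _.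
rewrite powRr1; last by rewrite mulr_ge0 ?powR_ge0 // ltW.
apply: (@le_trans _ _ (k.+1%:R `^ (- (2 * r j)))).
  by rewrite ler_piMl ?powR_ge0.
by rewrite ler_powR ?ler1n // lerN2 ler_pM2l // r_ge.
Qed.

(** The infimum that defines the complexity is approached within 1; the
    gap between the squares 1/4 and 1/3 of the relative errors leaves room for
    the infimum that defines the error. *)
Lemma complexity_half_witness (d : nat) (x : R) : (0 < d)%N ->
  (avg_complexity (P d) (@B d) 2^-1 <= x%:E)%E ->
  exists n : nat, [/\ (0 < n)%N, n%:R <= x + 1 &
    (avg_error (P d) (@B d) n < (Num.sqrt (tensor_trace d g r / 3))%:E)%E].
Proof.
move=> d0 nx; have : (avg_complexity (P d) (@B d) 2^-1 < (x + 1)%:E)%E.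
  by rewrite (le_lt_trans nx) // lte_fin ltrDl.
move=> /ereal_inf_lt[_ [n [n0 err] <-]]; rewrite lte_fin => nx1.
exists n; split=> //; first exact: ltW.
apply: (le_lt_trans err); rewrite (tensor_avg_error0 (hB d0)) -EFinM lte_fin.
have T1 : 1 <= tensor_trace d g r by exact: tensor_trace_ge1.
have -> : 2^-1 = Num.sqrt 4^-1 :> R.
  by rewrite (_ : 4^-1 = 2^-1 ^+ 2) ?sqrtr_sqr ?ger0_norm //; field.
rewrite -sqrtrM ?invr_ge0 // ltr_sqrt; lra.
Qed.

(** The power sum with exponent 1 + 1/v is bounded below by counting and
    above by its product form; comparing both bounds the sum of the
    g j (1 - g j^(1/v)). *)
Lemma weight_bound_of_witness (d n : nat) (v : R) : (0 < d)%N -> (0 < n)%N ->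
  (avg_error (P d) (@B d) n < (Num.sqrt (tensor_trace d g r / 3))%:E)%E ->
  0 < v -> 2 * ln d%:R <= v -> ln (10 * n%:R) <= v ->
  weight_sum d <= v * (4 + 4 * Z) + 2.
Proof.
move=> d0 n0 err v0 dv nv; have Z1 := Z_ge1.
pose T := tensor_trace d g r; rewrite -/T in err.
have T1 : 1 <= T by exact: tensor_trace_ge1.
have six0 : 0 < 6^-1 :> R by rewrite invr_gt0.
have [N [N0 TN]] := @tensor_trace_approx _ d g r _ g01 r2 six0.
set LN := \prod_(j < d) _ in TN; rewrite -/T in TN.
have /ltr_normlP[TN1 TN2] := TN.
have lam01 (i : mode d N) := tensor_eigenvalue_01 i g01 r_gt0.
have lam0 (i : mode d N) : 0 < tensor_eigenvalue g r i.
  by case/andP: (lam01 i).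
have lam1 (i : mode d N) : tensor_eigenvalue g r i <= 1.
  by case/andP: (lam01 i).
have sumE x := sum_tensor_eigenvalue d N x g01 r_gt0.
have LNE : \sum_(i : mode d N) tensor_eigenvalue g r i = LN.
  by rewrite /LN -sumE; apply: eq_bigr => i _; rewrite powRr1 // ltW.
have LN1 : 1 <= LN by exact: prod_marginal_sum_ge1.
have LN0 : 0 < LN by exact: lt_le_trans LN1.
have T3 : 0 <= T / 3 by lra.
have [p [p01 pn perr]] := tensor_avg_error_lt N r2 (hB d0) T3 err.
have TLN : T <= 6 / 5 * \sum_(i : mode d N) tensor_eigenvalue g r i.
  by rewrite LNE; lra.
have SLN1 : 1 <= \sum_(i : mode d N) tensor_eigenvalue g r i by rewrite LNE.
have [LNn powers] := rank_weights_bounds lam0 lam1 p01 pn perr TLN SLN1 n0.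
rewrite LNE in LNn powers.
have n10 : 0 < 10 * n%:R :> R by rewrite mulr_gt0 // ltr0n.
have g0 j : 0 < g j.+1 by case/andP: (g01 (isT : 0 < j.+1)%N).
have sum_g : \sum_(j < d) g j.+1 <= 2 * v.
  have : expR (\sum_(j < d) (2 / 3 * g j.+1)) <= expR v.
    apply: (@le_trans _ _ LN).
      rewrite expR_sum; apply: ler_prod => j _; rewrite expR_ge0 /=.
      by apply: expR_le_marginal_sum => //; exact: g01.
    by apply: (le_trans LNn); rewrite -[leLHS]lnK ?posrE // ler_expR.
  rewrite ler_expR -mulr_sumr; lra.
pose q := v^-1; have q0 : 0 < q by rewrite invr_gt0.
have sum_gq : \sum_(j < d) g j.+1 * (1 - g j.+1 `^ q) <= 1 + 2 * Z.
  pose E := \sum_(j < d) (2 * (g j.+1 * (1 - g j.+1 `^ q)) / (1 + 2 * Z)).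
  have up : LN / 2 * (10 * n%:R) `^ (- q) <= LN * expR (- E).
    apply: (le_trans (powers q q0)); rewrite sumE.
    rewrite -sumrN expR_sum -big_split /=; apply: ler_prod => j _.
    rewrite (le_trans ler01 (marginal_sum_ge1 _ _ _ _)) /=.
    apply: marginal_sum_powR1D_le => //; first exact: g01.
      exact: r_gt0.
    exact: marginal_sum_le.
  (* This is where v >= ln (10 n) is used: the power costs only a constant. *)
  have low : expR (- 1) <= (10 * n%:R) `^ (- q).
    rewrite powR_expR // ler_expR mulNr lerN2 /q mulrC ler_pdivrMr //.
    by rewrite mul1r.
  have half_e : 2^-1 * expR (- 1) <= expR (- E).
    rewrite -(ler_pM2l LN0) mulrA; apply: le_trans up.
    by rewrite ler_wpM2l // divr_ge0 // ltW.
  have e1 : expR (- 1) <= 2^-1 :> R.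
    rewrite expRN lef_pV2 ?posrE ?expR_gt0 //.
    by have := expR_ge1Dx (1 : R); lra.
  have : expR (- 2) <= expR (- E).
    apply: le_trans half_e; rewrite (_ : - 2 = - 1 + - 1); last by ring.
    by rewrite expRD ler_wpM2r ?expR_ge0.
  rewrite ler_expR lerN2 /E -mulr_suml -mulr_sumr ler_pdivrMr; lra.
have sum_gln : \sum_(j < d) g j.+1 * `|ln (g j.+1)| <= 2 * v * (1 + 2 * Z) + 2.
  apply: (@le_trans _ _ (\sum_(j < d)
      (2 * v * (g j.+1 * (1 - g j.+1 `^ q)) + 2 * d%:R^-1))).
    by apply: ler_sum => j _; apply: mul_norm_ln_le => //; exact: g01.
  rewrite big_split /= -!mulr_sumr sum_inv_nat // mulr1 lerD2r.
  by rewrite ler_wpM2l // mulr_ge0 // ltW.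
rewrite weight_sumE; lra.
Qed.

Lemma weight_bound_of_tractable :
  quasi_polynomially_tractable (fun d eps => avg_complexity (P d) (@B d) eps) ->
  exists A : R, forall d, (0 < d)%N -> weight_sum d <= A * ln_plus d%:R.
Proof.
move=> [C [s [C0 s0 nCs]]]; have Z1 := Z_ge1.
have ln20 : 0 <= ln 2 :> R by rewrite ln_ge0 // ler1n.
have lnC : 0 <= ln (10 * (C + 1)) by rewrite ln_ge0 //; lra.
(* The 2 makes v at least 2 ln d; the rest bounds ln (10 n). *)
pose c := ln (10 * (C + 1)) + s * (1 + ln 2) + 2.
have c2 : 2 <= c by rewrite /c lerDr addr_ge0 // mulr_ge0 //; lra.
exists (2 * c * (4 + 4 * Z) + 2) => d d0.
have [L1 dL LD] := ln_plus_bounds d0; set L := ln_plus _ in L1 dL LD *.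
have lnd : 0 <= ln (d%:R : R) by rewrite ln_ge0 // ler1n.
have half01 : 0 < (2^-1 : R) < 1 by rewrite invr_gt0 ltr0n invf_lt1 // ltr1n.
have := nCs d 2^-1 d0 half01; rewrite invrK.
set y := s * (1 + ln 2) * (1 + ln d%:R).
have y0 : 0 <= y by rewrite !mulr_ge0 //; lra.
move=> /(complexity_half_witness d0)[n [n0 nx err]].
have n0' : 0 < n%:R :> R by rewrite ltr0n.
pose v := c * (1 + ln d%:R).
have v2 : 2 * (1 + ln d%:R) <= v by rewrite /v ler_wpM2r //; lra.
have nv : ln (10 * n%:R) <= v.
  rewrite -[leRHS]expRK ler_ln ?posrE ?expR_gt0 ?mulr_gt0 //.
  have ey : 1 <= expR y by rewrite -[leLHS]expR0 ler_expR.
  apply: (@le_trans _ _ (10 * (C + 1) * expR y)); first by nra.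
  rewrite -[X in X * _]lnK ?posrE; last by lra.
  rewrite -expRD ler_expR /v /c /y.
  move: (ln (10 * (C + 1))) (s * (1 + ln 2)) lnC => a b a0; nra.
have v0 : 0 < v by lra.
have dv : 2 * ln d%:R <= v by lra.
apply: (le_trans (weight_bound_of_witness d0 n0 err v0 dv nv)).
have vL : v <= 2 * c * L.
  apply: (@le_trans _ _ (c * (2 * L))); last by lra.
  by rewrite /v ler_wpM2l //; lra.
have : v * (4 + 4 * Z) <= 2 * c * L * (4 + 4 * Z) by rewrite ler_wpM2r //; lra.
lra.
Qed.

End necessity.
End tractability.

Theorem theorem3 (R : realType) (r g : nat -> R)
    (hr : ((2^-1)%:E < ereal_inf [set (r j)%:E | j in [set j | (0 < j)%N]])%E)
    (hg0 : forall j : nat, (0 < j)%N -> 0 < g j)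
    (hg1 : (ereal_sup [set (g j)%:E | j in [set j | (0 < j)%N]] <= 1)%E)
    (disp : nat -> measure_display)
    (Om : forall d : nat, measurableType (disp d))
    (P : forall d : nat, probability (Om d) R)
    (B : forall d : nat, Om d -> L2 (@cube_measure R d))
    (hB : forall d : nat, (0 < d)%N ->
      zero_mean_field (P d) (@unit_cube R d)
        (@tensor_korobov_kernel R g r d) (B d)) :
  quasi_polynomially_tractable (fun d eps => avg_complexity (P d) (B d) eps)
  <->
  (ereal_sup [set ((ln_plus d%:R)^-1 *
                   \sum_(1 <= j < d.+1) (1 + `|ln (g j)|) * g j)%:E
             | d in [set d : nat | (0 < d)%N]] < +oo)%E.
Proof.
have r_mem j : (0 < j)%N -> (ereal_inf [set (r j)%:E | j in [set j | (0 < j)%N]]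
    <= (r j)%:E)%E by move=> j0; apply: ereal_inf_lbound; exists j.
have [r0 r0E] : exists r0 : R,
    ereal_inf [set (r j)%:E | j in [set j | (0 < j)%N]] = r0%:E.
  have := r_mem 1%N isT; move: hr; case: (ereal_inf _) => [r0 _ _|//|//].
  by exists r0.
rewrite r0E lte_fin in hr.
have r_ge j (j0 : (0 < j)%N) : r0 <= r j by rewrite -lee_fin -r0E r_mem.
have g01 j : (0 < j)%N -> 0 < g j <= 1.
  move=> j0; rewrite hg0 //= -lee_fin; apply: le_trans hg1.
  by apply: ereal_sup_ubound; exists j.
have L0 d : (0 < d)%N -> 0 < ln_plus (d%:R : R).
  by move=> d0; have [L1 _ _] := @ln_plus_bounds R d d0; exact: lt_le_trans L1.
split=> [tract|bounded].
  have [A weight_le] := weight_bound_of_tractable hr r_ge g01 hB tract.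
  apply: (@le_lt_trans _ _ A%:E); last exact: ltry.
  apply: ge_ereal_sup => _ [d d0 <-]; rewrite lee_fin mulrC.
  by rewrite ler_pdivrMr ?L0 // weight_le.
set S := ereal_sup _ in bounded.
have S_ge d : (0 < d)%N -> (((ln_plus d%:R)^-1 *
    \sum_(1 <= j < d.+1) (1 + `|ln (g j)|) * g j)%:E <= S)%E.
  by move=> d0; apply: ereal_sup_ubound; exists d.
have [A AE] : exists A : R, S = A%:E.
  by have := S_ge 1%N isT; move: bounded; case: S {S_ge} => [A _ _|//|//]; exists A.
have weight_le d : (0 < d)%N ->
    \sum_(1 <= j < d.+1) (1 + `|ln (g j)|) * g j <= A * ln_plus d%:R.
  move=> d0; have := S_ge d d0; rewrite AE lee_fin mulrC.
  by rewrite ler_pdivrMr ?L0.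
apply: (tractable_of_weight_bound hr r_ge g01 hB _ weight_le).
rewrite -lee_fin -AE; apply: le_trans (S_ge 1%N isT); rewrite lee_fin.
rewrite mulr_ge0 ?invr_ge0 ?(ltW (L0 _ _)) // big_add1 sumr_ge0 // => j _.
by rewrite mulr_ge0 ?addr_ge0 // ltW // hg0.
Qed.
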